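(* Let $\mathcal{U}\subset\mathcal{M}$ be an amenable subset. Then $\overline{\mathcal{U}}$, the completion of $\mathcal{U}$ with respect to $d$, can be identified with $\mathcal{U}^0$, the completion of $\mathcal{U}$ with respect to $\|\cdot\|_g$, via a natural homeomorphism $\overline{\mathcal{U}}\to\mathcal{U}^0$ (the unique uniformly continuous extension of the identity map $(\mathcal{U},d)\to(\mathcal{U},\|\cdot\|_g)$). This homeomorphism becomes an isometry if $\mathcal{U}^0$ is given the metric $$d(g_0,g_1)=\lim_{k\to\infty}d(g^0_k,g^1_k),$$ where $\{g^0_k\}$ and $\{g^1_k\}$ are any sequences in $\mathcal{U}$ that $L^2$-converge to $g_0$ and $g_1$, respectively.
   Context: $M$ is a closed, orientable, $n$-dimensional $C^\infty$ manifold. $\mathcal{S}$ is the Fréchet space of smooth symmetric $(0,2)$-tensor fields on $M$ and $\mathcal{M}\subset\mathcal{S}$ the open subset of smooth Riemannian metrics, so $T_{\tilde g}\mathcal{M}\cong\mathcal{S}$. The $L^2$ metric on $\mathcal{M}$ is the weak Riemannian metric $(h,k)_{\tilde g}=\int_M \mathrm{tr}(\tilde g^{-1}h\tilde g^{-1}k)\,d\mu_{\tilde g}$, and $d$ is its distance function (infimum of lengths of paths in $\mathcal{M}$), which is known to be a metric. Fix a reference metric $g\in\mathcal{M}$; $\|h\|_g=\sqrt{(h,h)_g}$, and ''$L^2$-convergence'' is convergence with respect to $\|\cdot\|_g$. A finite atlas $\{(U_\alpha,\phi_\alpha)\}$ of $M$ is called amenable if for each $\alpha$ there are a compact set $K_\alpha$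 and a coordinate chart $(V_\alpha,\psi_\alpha)$ with $U_\alpha\subset K_\alpha\subset V_\alpha$ and $\phi_\alpha=\psi_\alpha|U_\alpha$. A fixed amenable atlas is used for all coordinate expressions; coordinate bounds are meant to hold in every chart of the atlas containing the point. For $\tilde g\in\mathcal{M}$ put $\tilde G=g^{-1}\tilde g$ (locally $\tilde G^i_j=g^{ik}\tilde g_{kj}$) and let $\lambda^{\tilde G}_{\min}(x)$ be the smallest eigenvalue of $\tilde G(x)$. A subset $\mathcal{U}\subset\mathcal{M}$ is amenable if it is convex and there are constants $C,\delta>0$ such that for all $\tilde g\in\mathcal{U}$, $x\in M$, $1\le i,j\le n$: $\lambda^{\tilde G}_{\min}(x)\ge\delta$ and $|\tilde g_{ij}(x)|\le C$. *)

(* Defs.v *)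
From HB Require Import structures.
From mathcomp Require Import all_boot all_order all_algebra.
From mathcomp Require Export all_classical all_reals all_analysis.

Set Implicit Arguments.
Unset Strict Implicit.
Unset Printing Implicit Defensive.

Import Order.TTheory GRing.Theory Num.Theory.
Import numFieldNormedType.Exports.

Local Open Scope classical_set_scope.
Local Open Scope ring_scope.

(* R^n is carried by n.-tuple R, on which the library puts the product
   sigma-algebra; R^(n+1) is R x R^n through (x, t) |-> x :: t. *)
Section lebesgue_cons.
Context {R : realType} {n : nat}.
Local Notation T := (measurableTypeR R).
Variable mu : {sigma_finite_measure set (n.-tuple T) -> \bar R}.

Definition tcons (p : T * n.-tuple T) : n.+1.-tuple T := [tuple of p.1 :: p.2].

Lemma measurable_tcons : measurable_fun [set: T * n.-tuple T] tcons.
Proof.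
exact: (measurable_cons (f := fst) (g := snd) measurable_fst measurable_snd).
Qed.

Definition lebesgue_cons : set (n.+1.-tuple T) -> \bar R :=
  pushforward (@lebesgue_measure R \x mu)%E tcons.

Let lebesgue_cons0 : lebesgue_cons set0 = 0%E.
Proof. by rewrite /lebesgue_cons /pushforward preimage_set0 measure0. Qed.

Let lebesgue_cons_ge0 A : (0 <= lebesgue_cons A)%E.
Proof. by rewrite /lebesgue_cons /pushforward; exact: measure_ge0. Qed.

Let lebesgue_cons_sigma_additive : semi_sigma_additive lebesgue_cons.
Proof.
move=> F mF tF mUF; rewrite /lebesgue_cons /pushforward preimage_bigcup.
apply: measure_semi_sigma_additive.
- by move=> k; rewrite -[X in measurable X]setTI; exact: measurable_tcons.
- apply/trivIsetP => /= i j _ _ ij; rewrite -preimage_setI.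
  by move/trivIsetP : tF => /(_ _ _ _ _ ij) ->//; rewrite preimage_set0.
- by rewrite -preimage_bigcup -[X in measurable X]setTI; exact: measurable_tcons.
Qed.

HB.instance Definition _ := isMeasure.Build _ _ _
  lebesgue_cons lebesgue_cons0 lebesgue_cons_ge0 lebesgue_cons_sigma_additive.

Let lebesgue_cons_sigma_finite : sigma_finite setT lebesgue_cons.
Proof.
have /sigma_finiteP[F [FT ndF mF]] := sigma_finiteT (@lebesgue_measure R).
have /sigma_finiteP[G [GT ndG mG]] := sigma_finiteT mu.
pose h (t : n.+1.-tuple T) : T * n.-tuple T := (thead t, [tuple of behead t]).
have mh : measurable_fun setT h.
  apply/measurable_fun_pairP; split => /=; last exact: measurable_behead.
  exact: measurable_tnth.
exists (fun i => h @^-1` (F i `*` G i)) => [|i].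
  rewrite -preimage_bigcup; apply/esym/seteqP; split => // t _.
  have [k _ Fk] : (\bigcup_i F i) (h t).1 by rewrite -FT.
  have [l _ Gl] : (\bigcup_i G i) (h t).2 by rewrite -GT.
  exists (maxn k l) => //; split.
    by have /subsetPset := ndF _ _ (leq_maxl k l); exact.
  by have /subsetPset := ndG _ _ (leq_maxr k l); exact.
have [mFi Fi] := mF i; have [mGi Gi] := mG i.
have mFG : measurable (F i `*` G i) by exact: measurableX.
split; first by rewrite -[X in measurable X]setTI; exact: mh.
rewrite /lebesgue_cons /pushforward -comp_preimage.
have -> : h \o tcons = id.
  by apply/funext => -[x t] /=; congr pair; exact/val_inj.
rewrite [X in (X < _)%E]product_measure1E// lte_mul_pinfty//.
by rewrite ge0_fin_numE.
Qed.

HB.instance Definition _ := Measure_isSigmaFinite.Build _ _ _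
  lebesgue_cons lebesgue_cons_sigma_finite.

End lebesgue_cons.

Section lebesgue_tuple.
Context {R : realType}.
Local Notation T := (measurableTypeR R).

Fixpoint lebesgue_tuple n : {sigma_finite_measure set (n.-tuple T) -> \bar R} :=
  if n is k.+1 then lebesgue_cons (lebesgue_tuple k)
  else dirac ([tuple] : 0.-tuple T).

Definition rV_of_tuple n (t : n.-tuple T) : 'rV[R]_n := \row_i tnth t i.

Definition integral_rV n (D : set 'rV[R]_n) (f : 'rV[R]_n -> R) : R :=
  \int[lebesgue_tuple n]_(t in @rV_of_tuple n @^-1` D) f (rV_of_tuple t).

End lebesgue_tuple.

Section smooth_functions.
Context {R : realType} {n : nat}.

Definition pderivs (s : seq 'I_n) (f : 'rV[R]_n -> R) : 'rV[R]_n -> R :=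
  foldr (fun i h => 'D_(delta_mx 0 i) h) f s.

Definition smooth_on (D : set 'rV[R]_n) (f : 'rV[R]_n -> R) : Prop :=
  forall (s : seq 'I_n) y, D y -> differentiable (pderivs s f) y.

Definition smooth_map_on (D : set 'rV[R]_n) (F : 'rV[R]_n -> 'rV[R]_n) : Prop :=
  forall j, smooth_on D (fun y => F y 0 j).

End smooth_functions.

(* [cmap] and [cinv] are total functions; only their values on [cdom] and on
   [cmap @` cdom] matter. *)
Record chart (R : realType) (n : nat) (M : topologicalType) := Chart {
  cdom : set M ;
  cmap : M -> 'rV[R]_n ;
  cinv : 'rV[R]_n -> M ;
  cdom_open : open cdom ;
  cran_open : open (cmap @` cdom) ;
  cmapK : forall x, cdom x -> cinv (cmap x) = x ;
  cmap_continuous : {within cdom, continuous cmap} ;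
  cinv_continuous : {within cmap @` cdom, continuous cinv}
}.

Section chart_transition.
Context {R : realType} {n : nat} {M : topologicalType}.
Implicit Types c : chart R n M.

Definition cran c : set 'rV[R]_n := cmap c @` cdom c.

Definition overlap c c' : set 'rV[R]_n := cmap c @` (cdom c `&` cdom c').

Definition transition c c' : 'rV[R]_n -> 'rV[R]_n := cmap c' \o cinv c.

Definition smooth_compat c c' : Prop :=
  smooth_map_on (overlap c c') (transition c c') /\
  smooth_map_on (overlap c' c) (transition c' c).

End chart_transition.

(* [atlas] is the maximal atlas.  [chart_at x] is a choice of a chart around x;
   it serves to identify the tangent space at x with R^n. *)
Record smooth_structure (R : realType) (n : nat) (M : topologicalType) := {
  atlas : set (chart R n M) ;
  atlas_compat : forall c c', atlas c -> atlas c' -> smooth_compat c c' ;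
  atlas_max : forall c, (forall c', atlas c' -> smooth_compat c c') -> atlas c ;
  chart_at : M -> chart R n M ;
  chart_at_atlas : forall x, atlas (chart_at x) ;
  chart_at_dom : forall x, cdom (chart_at x) x
}.

Definition closed_manifold (M : topologicalType) : Prop :=
  compact [set: M] /\ hausdorff_space M.

Definition orientable (R : realType) (n : nat) (M : topologicalType)
    (S : smooth_structure R n M) : Prop :=
  exists B : set (chart R n M), [/\ B `<=` atlas S,
    forall x, exists2 c, B c & cdom c x &
    forall c c' y, B c -> B c' -> overlap c c' y ->
      0 < \det ('J (transition c c') y)].

(* The coordinate charts phi_alpha are the restrictions of [aV alpha] to
   [aU alpha]. *)
Record amenable_atlas (R : realType) (n : nat) (M : topologicalType)
    (S : smooth_structure R n M) := AmenableAtlas {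
  asize : nat ;
  aU : 'I_asize -> set M ;
  aK : 'I_asize -> set M ;
  aV : 'I_asize -> chart R n M ;
  aU_open : forall a, open (aU a) ;
  aK_compact : forall a, compact (aK a) ;
  aUK : forall a, aU a `<=` aK a ;
  aKV : forall a, aK a `<=` cdom (aV a) ;
  aV_atlas : forall a, atlas S (aV a) ;
  aU_cover : forall x, exists a, aU a x
}.

(* A (0,2)-tensor field: [h x] is the matrix of the bilinear form h_x on T_xM
   in the chart [chart_at x], so that h_x(u, v) = u *m h x *m v^T for row
   vectors u, v. *)
Notation tensor R n M := (M -> 'M[R]_n).

Section tensor_fields.
Context {R : realType} {n : nat} {M : topologicalType}.
Variable S : smooth_structure R n M.
Implicit Types (h k g : tensor R n M) (c : chart R n M).

(* Matrix (h_ij(x)) of the components of h in the chart c, for x in cdom c; the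
   i-th coordinate vector of c has coordinates row i J in the chart at x. *)
Definition comp c h (x : M) : 'M[R]_n :=
  let J := 'J (transition c (chart_at S x)) (cmap c x) in J *m h x *m J^T.

Definition smooth_tensor h : Prop :=
  forall c i j, atlas S c -> smooth_on (cran c) (fun y => comp c h (cinv c y) i j).

Definition sym_tensors : set (tensor R n M) :=
  [set h | smooth_tensor h /\ forall x, (h x)^T = h x].

Definition metrics : set (tensor R n M) :=
  [set g | sym_tensors g /\
    forall x (v : 'rV[R]_n), v != 0 -> 0 < (v *m g x *m v^T) 0 0].

Variable A : amenable_atlas S.

(* The pieces U_a minus the union of the U_b, b < a, form a finite Borel
   partition of M; any other such partition subordinate to charts gives the same
   [integral_M], by the change of variables formula. *)
Definition piece (a : 'I_(asize A)) : set M :=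
  aU a `\` \bigcup_(b in [set b : 'I_(asize A) | (b < a)%N]) aU b.

(* \int_M f dmu_g, where dmu_g = sqrt(det g_ij) dx^1...dx^n in coordinates. *)
Definition integral_M g (f : M -> R) : R :=
  \sum_(a < asize A) integral_rV (cmap (aV a) @` piece a)
    (fun y => f (cinv (aV a) y) * Num.sqrt (\det (comp (aV a) g (cinv (aV a) y)))).

(* The trace is that of an endomorphism of T_xM, hence computed in the chart
   at x. *)
Definition L2 g h k : R :=
  integral_M g (fun x => \tr (invmx (g x) *m h x *m invmx (g x) *m k x)).

Definition L2norm g h : R := Num.sqrt (L2 g h h).

Definition L2dist g h k : R := L2norm g (h - k).

(* Convergence in the C^oo topology: uniform convergence of all the partial
   derivatives of the components on the compact sets K_a. *)
Definition smooth_cvg (F : set_system R) (u : R -> tensor R n M)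
    (l : tensor R n M) : Prop :=
  forall (a : 'I_(asize A)) (i j : 'I_n) (s : seq 'I_n) (e : R), 0 < e ->
    \forall t \near F, forall x, aK a x ->
      `|pderivs s (fun y => comp (aV a) (u t - l) (cinv (aV a) y) i j)
          (cmap (aV a) x)| < e.

(* p is C^1 on the closed interval [a, b] as a map into the Frechet space of
   [sym_tensors], with derivative p' (one-sided at a and b). *)
Definition C1_path (p p' : R -> tensor R n M) (a b : R) : Prop :=
  forall t, t \in `[a, b] ->
    [/\ metrics (p t), sym_tensors (p' t),
        smooth_cvg (within `[a, b] t^') (fun s => (s - t)^-1 *: (p s - p t)) (p' t) &
        smooth_cvg (within `[a, b] (nbhs t)) p' (p' t)].

(* [path_length p a b l]: over [a, b], p is a piecewise C^1 path of length l.
   Paths may be parametrised by any [a, b], a < b, length being invariant under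
   affine reparametrisation. *)
Inductive path_length (p : R -> tensor R n M) : R -> R -> R -> Prop :=
| path_length_C1 (a b : R) (p' : R -> tensor R n M) : a < b -> C1_path p p' a b ->
    path_length p a b (\int[lebesgue_measure]_(t in `[a, b]) L2norm (p t) (p' t))
| path_length_cat (a b c l l' : R) : path_length p a b l -> path_length p b c l' ->
    path_length p a c (l + l').

Definition L2_distance g0 g1 : R :=
  inf [set l | exists (p : R -> tensor R n M) a b,
    [/\ p a = g0, p b = g1 & path_length p a b l]].

(* g^-1 gt is self-adjoint with respect to g, so that its spectrum is real and,
   when 0 < n, nonempty. *)
Definition lambda_min (B : 'M[R]_n) : R := inf [set l | eigenvalue B l].

Definition amenable g (U : set (tensor R n M)) : Prop :=
  [/\ U `<=` metrics, @convex_set R (tensor R n M) U &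
    exists C delta : R, [/\ 0 < C, 0 < delta &
      forall gt, U gt ->
        (forall x, delta <= lambda_min (invmx (g x) *m gt x)) /\
        (forall a x i j, aU a x -> `|comp (aV (a : 'I_(asize A))) gt x i j| <= C)]].

End tensor_fields.

(* iota exhibits Y as a completion of U with respect to the distance d. *)
Definition is_completion (R : realType) (T : Type) (U : set T) (d : T -> T -> R)
    (Y : metricType R) (iota : U -> Y) : Prop :=
  [/\ forall x y : U, mdist (iota x) (iota y) = d (\val x) (\val y),
      dense (range iota) &
      forall u : nat -> Y, cauchy (u @ \oo) -> exists l : Y, u @ \oo --> l].

Definition is_distance (R : realType) (Z : Type) (D : Z -> Z -> R) : Prop :=
  [/\ forall x y, D x y = 0 <-> x = y,
      forall x y, D x y = D y x &
      forall x y z, D x z <= D x y + D y z].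

(* Main.v *)
Require Import Defs.
From mathcomp Require Import all_boot all_order all_algebra.
From mathcomp Require Import all_classical all_reals all_analysis.
From mathcomp Require Import perm measurable_realfun ring lra.

Set Implicit Arguments.
Unset Strict Implicit.
Unset Printing Implicit Defensive.

Import Order.TTheory GRing.Theory Num.Theory.
Import numFieldNormedType.Exports.

Local Open Scope classical_set_scope.
Local Open Scope ring_scope.

(** On an amenable set U the distance d of the L2 metric and the norm of g are
    bi-Lipschitz equivalent ([L2_distance_equiv_L2dist]).  Completions for
    bi-Lipschitz equivalent distances are identified by the extension of the
    identity, and the distance of one of them can be carried to the other
    ([bilipschitz_completions]).

    Both distances are compared with the L2 norm of the components in the charts,
    taken with respect to Lebesgue measure.  The size of a positive definite
    matrix A and its closeness to degenerate ones are measured together by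
    T = 1 + tr A + tr A^-1 ([distortion]).  If T is bounded, the pointwise norm
    (tr (A^-1 h A^-1 h) sqrt (det A))^(1/2) is comparable with the Euclidean norm
    of h.  This applies to g, by compactness, and uniformly to the metrics of U:
    the least eigenvalue of g^-1 gt is the minimum of a Rayleigh quotient, so
    that the eigenvalue bound reads gt >= delta g and bounds tr A^-1
    ([amenable_distortion_bound]).  As U is convex, the segment between two
    metrics of U has a length bounded by a multiple of their L2 distance.

    The converse inequality must deal with paths that leave U and come close to
    degenerate or to very large metrics.  The functions T^-(n+1) and T^-(n+1) A_ij
    ([observable]) decay so fast that their differentials are bounded by a constant
    times the pointwise norm above, on the whole cone of positive definite
    matrices ([sqr_d_observable_le]).  Let p be any path, f an observable and psi
    a fixed function of the coordinates.  By Cauchy-Schwarz, the integral of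
    f(p_t) psi changes at a speed of at most C |psi| |p'_t|, so its increment is at
    most C |psi| length(p) ([path_length_observable]); for psi = f(p_1) - f(p_0)
    this says |f(p_1) - f(p_0)| <= C length(p), in the L2 norm of the coordinates.
    Where T is bounded, the entries A_ij are Lipschitz functions of the observables
    ([sqnorm_sub_le_observable]), so the distance of the endpoints is bounded by a
    multiple of the length as soon as the endpoints, but not necessarily the path,
    belong to U.

    Differentiation under the integral sign rests on uniform convergence.  The
    difference quotients of p converge uniformly on the compact sets of the atlas;
    those of f(p) are computed along the filter of s -> t and y -> y0, and by
    compactness convergence along all these filters is again uniform
    ([unif_cvgP]). *)

(** * Positive definite matrices *)

Section posdef.
Variable R : rcfType.

Definition posdef n (A : 'M[R]_n) : Prop :=
  A^T = A /\ forall v : 'rV[R]_n, v != 0 -> 0 < (v *m A *m v^T) 0 0.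

Definition sqnorm m n (h : 'M[R]_(m, n)) : R := \sum_i \sum_j h i j ^+ 2.

Definition metric_sqnorm n (A h : 'M[R]_n) : R :=
  \tr (invmx A *m h *m invmx A *m h).

(** The integrand of the squared L2 norm of h at the metric A, with respect to
    the Lebesgue measure of the coordinates. *)
Definition energy_density n (A h : 'M[R]_n) : R :=
  metric_sqnorm A h * Num.sqrt (\det A).

Lemma posdef_unit n (A : 'M[R]_n) : posdef A -> A \in unitmx.
Proof.
move=> [_ pA]; rewrite unitmxE unitfE; apply/negP => /det0P[v v0 vA].
by have := pA v v0; rewrite vA mul0mx mxE ltxx.
Qed.

Lemma posdef_congr n (J A : 'M[R]_n) :
  J \in unitmx -> posdef A -> posdef (J *m A *m J^T).
Proof.
move=> uJ [sA pA]; split; first by rewrite !trmx_mul trmxK sA mulmxA.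
move=> v v0; have := pA (v *m J); rewrite trmx_mul !mulmxA; apply.
by apply: contra_neq v0 => vJ; rewrite -(mulmxK uJ v) vJ mul0mx.
Qed.

Lemma posdef_inv n (A : 'M[R]_n) : posdef A -> posdef (invmx A).
Proof.
move=> pA; have uA := posdef_unit pA.
have iA : invmx A \in unitmx by rewrite unitmx_inv.
have -> : invmx A = invmx A *m A *m (invmx A)^T.
  by rewrite trmx_inv pA.1 mulVmx// mul1mx.
exact: posdef_congr.
Qed.

(** Completing the square: the Schur complement of the upper left entry is
    again positive definite, and a Gram factor of it extends to one of A. *)
Lemma posdef_gram n (A : 'M[R]_n) : posdef A -> exists B : 'M[R]_n, A = B *m B^T.
Proof.
elim: n A => [A _|n IH A]; first by exists 0; apply/matrixP => -[].
rewrite -[n.+1]/(1 + n)%N in A * => -[sA pA].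
pose a := A 0 0; pose b : 'rV[R]_n := ursubmx A; pose D := drsubmx A.
have ulA : ulsubmx A = a%:M.
  by rewrite [LHS]mx11_scalar !mxE /a; congr ((A _ _)%:M); exact/val_inj.
have dlA : dlsubmx A = b^T by rewrite /b trmx_ursub sA.
have sD : D^T = D by rewrite /D trmx_drsub sA.
have AE : A = block_mx a%:M b b^T D by rewrite -ulA -dlA submxK.
have a0 : 0 < a.
  have /pA : row_mx 1%:M 0 != 0 :> 'rV[R]_(1 + n).
    by apply/eqP => /matrixP/(_ 0 (lshift n 0)); rewrite row_mxEl !mxE => /eqP;
      rewrite oner_eq0.
  rewrite AE mul_row_block !mul0mx !mul1mx !addr0 tr_row_mx mul_row_col trmx0.
  by rewrite mulmx0 addr0 trmx1 mulmx1 mxE eqxx.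
pose S := D - a^-1 *: (b^T *m b).
have pS : posdef S.
  split=> [|w w0]; first by rewrite /S linearB linearZ/= trmx_mul trmxK sD.
  pose v : 'rV[R]_(1 + n) := row_mx (- a^-1 *: (w *m b^T)) w.
  have v0 : v != 0.
    apply: contra_neq w0 => vE; rewrite -[LHS](row_mxKr (- a^-1 *: (w *m b^T))).
    by rewrite -/v vE linear0.
  have := pA v v0; rewrite AE mul_row_block.
  rewrite mul_mx_scalar scalerA mulrN divff ?gt_eqF// scaleN1r addNr.
  rewrite tr_row_mx mul_row_col mul0mx add0r /S.
  by rewrite mulmxBr -scalemxAr -scalemxAl !mulmxA addrC scaleNr.
have [C SE] := IH _ pS.
exists (block_mx (Num.sqrt a)%:M 0 ((Num.sqrt a)^-1 *: b^T) C).
have sa0 : Num.sqrt a != 0 by rewrite gt_eqF// sqrtr_gt0.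
rewrite tr_block_mx mulmx_block !trmx0 !mulmx0 !mul0mx !addr0 AE.
rewrite tr_scalar_mx !mul_scalar_mx scale_scalar_mx -expr2 sqr_sqrtr ?ltW//.
rewrite linearZ/= trmxK scalerA divff// scale1r mul_mx_scalar scalerA divff// scale1r.
rewrite -SE /S -scalemxAl -scalemxAr scalerA -expr2 exprVn sqr_sqrtr ?ltW//.
by rewrite addrC subrK.
Qed.

Lemma mxtrace_mul_tr m n (B : 'M[R]_(m, n)) : \tr (B *m B^T) = sqnorm B.
Proof.
rewrite /mxtrace /sqnorm; apply: eq_bigr => i _; rewrite mxE.
by apply: eq_bigr => j _; rewrite mxE expr2.
Qed.

Lemma sqnorm_ge0 m n (B : 'M[R]_(m, n)) : 0 <= sqnorm B.
Proof. by apply: sumr_ge0 => i _; apply: sumr_ge0 => j _; exact: sqr_ge0. Qed.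

Lemma sqr_le_sqnorm m n (B : 'M[R]_(m, n)) i j : B i j ^+ 2 <= sqnorm B.
Proof.
rewrite /sqnorm (bigD1 i)//= (bigD1 j)//= -addrA lerDl addr_ge0//.
  by apply: sumr_ge0 => k _; exact: sqr_ge0.
by apply: sumr_ge0 => k _; apply: sumr_ge0 => l _; exact: sqr_ge0.
Qed.

Lemma norm_le_sqrt_sqnorm m n (B : 'M[R]_(m, n)) i j :
  `|B i j| <= Num.sqrt (sqnorm B).
Proof. by rewrite -sqrtr_sqr ler_wsqrtr// sqr_le_sqnorm. Qed.

Lemma sqnorm_le m n (B : 'M[R]_(m, n)) k :
  (forall i j, `|B i j| <= k) -> sqnorm B <= (m * n)%:R * k ^+ 2.
Proof.
move=> Bk; apply: (@le_trans _ _ (\sum_(i < m) \sum_(j < n) k ^+ 2)).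
  apply: ler_sum => i _; apply: ler_sum => j _.
  by rewrite -real_normK ?num_real// lerXn2r// nnegrE (le_trans _ (Bk i j)).
by rewrite !sumr_const !card_ord -mulrnA mulnC mulr_natl.
Qed.

Lemma norm_mul_le_sqnorm m n (B : 'M[R]_(m, n)) i j k l :
  `|B i j * B k l| <= sqnorm B.
Proof.
rewrite normrM; have := sqr_le_sqnorm B i j; have := sqr_le_sqnorm B k l.
rewrite -[B i j ^+ 2]real_normK ?num_real// -[B k l ^+ 2]real_normK ?num_real//.
by have := sqr_ge0 (`|B i j| - `|B k l|); nra.
Qed.

(** Each product of two entries of C is at most the trace of C C^T, and an
    entry of C m C^T has n^2 terms.  Here and below only the form of the
    constants matters, not their value. *)
Lemma congr_entry_le n (C m : 'M[R]_n) k i j : (forall a b, `|m a b| <= k) ->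
  `|(C *m m *m C^T) i j| <= (n ^ 2)%:R * \tr (C *m C^T) * k.
Proof.
move=> mk; rewrite mxtrace_mul_tr mxE.
apply: (le_trans (ler_norm_sum _ _ _)).
apply: (@le_trans _ _ (\sum_(b < n) \sum_(a < n) sqnorm C * k)); last first.
  rewrite !sumr_const !card_ord -mulrnA.
  by rewrite mulr_natl mulrnAl mulnn.
apply: ler_sum => b _; rewrite !mxE mulr_suml.
apply: (le_trans (ler_norm_sum _ _ _)); apply: ler_sum => a _.
by rewrite mulrAC normrM ler_pM// norm_mul_le_sqnorm.
Qed.

Lemma posdef_entry_le n (A : 'M[R]_n) i j : posdef A -> `|A i j| <= \tr A.
Proof.
move=> /posdef_gram[B ->]; rewrite mxtrace_mul_tr mxE.
have -> : sqnorm B = \sum_b \sum_a B a b ^+ 2 by rewrite /sqnorm exchange_big.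
apply: (le_trans (ler_norm_sum _ _ _)); apply: ler_sum => b _; rewrite mxE.
have sqb l : B l b ^+ 2 <= \sum_a B a b ^+ 2.
  by rewrite (bigD1 l)//= lerDl; apply: sumr_ge0 => k _; exact: sqr_ge0.
rewrite normrM; have := sqb i; have := sqb j.
rewrite -[B i b ^+ 2]real_normK ?num_real// -[B j b ^+ 2]real_normK ?num_real//.
by have := sqr_ge0 (`|B i b| - `|B j b|); nra.
Qed.

Lemma posdef_tr_ge0 n (A : 'M[R]_n) : posdef A -> 0 <= \tr A.
Proof. by move=> /posdef_gram[B ->]; rewrite mxtrace_mul_tr sqnorm_ge0. Qed.

Lemma posdef_det_gt0 n (A : 'M[R]_n) : posdef A -> 0 < \det A.
Proof.
move=> pA; have := posdef_unit pA; rewrite unitmxE unitfE.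
have [B ->] := posdef_gram pA.
by rewrite det_mulmx det_tr -expr2 => d0; rewrite lt_neqAle eq_sym d0 sqr_ge0.
Qed.

(** Leibniz formula, the entries being bounded by the trace. *)
Lemma posdef_det_le n (A : 'M[R]_n) : posdef A -> \det A <= (n`!)%N%:R * \tr A ^+ n.
Proof.
move=> pA; apply: (le_trans (ler_norm _)).
apply: (le_trans (ler_norm_sum _ _ _)).
apply: (@le_trans _ _ (\sum_(s : 'S_n) \tr A ^+ n)); last first.
  by rewrite sumr_const card_Sn mulr_natl.
apply: ler_sum => s _; rewrite normrM normr_sign mul1r normr_prod.
have -> : \tr A ^+ n = \prod_(i < n) \tr A by rewrite prodr_const card_ord.
by apply: ler_prod => i _; rewrite normr_ge0 posdef_entry_le.
Qed.

(** In the frame B, where A = B B^T, the metric norm of h is the Euclidean norm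
    of the symmetric matrix B^-1 h B^-T. *)
Lemma metric_sqnorm_frame n (A h : 'M[R]_n) : posdef A -> h^T = h ->
  exists B m : 'M[R]_n, [/\ B \in unitmx, A = B *m B^T, h = B *m m *m B^T &
    metric_sqnorm A h = sqnorm m].
Proof.
move=> pA sh; have [B AE] := posdef_gram pA.
have uB : B \in unitmx.
  by have := posdef_unit pA; rewrite AE unitmx_mul => /andP[].
have uBT : B^T \in unitmx by rewrite unitmx_tr.
have iAE : invmx A = (invmx B)^T *m invmx B.
  have /(congr1 (mulmx ((invmx B)^T *m invmx B))) := mulmxV (posdef_unit pA).
  by rewrite mulmx1 {1}AE !mulmxA mulmxKV// trmx_inv mulVmx// mul1mx.
exists B, (invmx B *m h *m (invmx B)^T); split => //.
  by rewrite trmx_inv !mulmxA mulmxV// mul1mx mulmxKV.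
rewrite -mxtrace_mul_tr /metric_sqnorm iAE !trmx_mul sh trmxK -!mulmxA.
by rewrite mxtrace_mulC !mulmxA.
Qed.

Lemma metric_sqnorm_ge0 n (A h : 'M[R]_n) : posdef A -> h^T = h ->
  0 <= metric_sqnorm A h.
Proof.
by move=> pA /(metric_sqnorm_frame pA)[B [m [_ _ _ ->]]]; exact: sqnorm_ge0.
Qed.

Lemma entry_le_metric n (A h : 'M[R]_n) i j : posdef A -> h^T = h ->
  `|h i j| <= (n ^ 2)%:R * \tr A * Num.sqrt (metric_sqnorm A h).
Proof.
move=> pA sh; have [B [m [_ -> -> ->]]] := metric_sqnorm_frame pA sh.
by apply: congr_entry_le => a b; exact: norm_le_sqrt_sqnorm.
Qed.

Lemma inv_entry_le_metric n (A h : 'M[R]_n) i j : posdef A -> h^T = h ->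
  `|(invmx A *m h *m invmx A) i j| <=
    (n ^ 2)%:R * \tr (invmx A) * Num.sqrt (metric_sqnorm A h).
Proof.
move=> pA sh; rewrite [metric_sqnorm A h](_ : _ =
    metric_sqnorm (invmx A) (invmx A *m h *m invmx A)); last first.
  rewrite /metric_sqnorm invmxK !mulmxA mulmxV ?posdef_unit// mul1mx.
  by rewrite mulmxKV ?posdef_unit// mxtrace_mulC !mulmxA.
apply: entry_le_metric; first exact: posdef_inv.
by rewrite !trmx_mul trmx_inv pA.1 sh mulmxA.
Qed.

Lemma metric_sqnorm_le n (A h : 'M[R]_n) : posdef A -> h^T = h ->
  metric_sqnorm A h <= (n * n)%:R * ((n ^ 2)%:R * \tr (invmx A)) ^+ 2 * sqnorm h.
Proof.
move=> pA sh; have [B [m [uB AE hE ->]]] := metric_sqnorm_frame pA sh.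
have uBT : B^T \in unitmx by rewrite unitmx_tr.
rewrite -mulrA -[sqnorm h in X in _ <= X]sqr_sqrtr ?sqnorm_ge0// -exprMn.
apply: sqnorm_le => i j.
have -> : m = invmx B *m h *m (invmx B)^T.
  by rewrite hE trmx_inv !mulmxA mulVmx// mul1mx mulmxK.
have -> : \tr (invmx A) = \tr (invmx B *m (invmx B)^T).
  have /(congr1 (mulmx ((invmx B)^T *m invmx B))) := mulmxV (posdef_unit pA).
  rewrite mulmx1 {1}AE !mulmxA mulmxKV// trmx_inv mulVmx// mul1mx => ->.
  by rewrite mxtrace_mulC.
by apply: congr_entry_le => a b; exact: norm_le_sqrt_sqnorm.
Qed.

End posdef.

(** * Limits and difference quotients along a filter *)

Section limits_along_a_filter.
Context {R : realType} {T : Type} (F : set_system T) {FF : Filter F}.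

Lemma near_neq0 (f : T -> R) (l : R) : f t @[t --> F] --> l -> l != 0 ->
  \forall t \near F, f t != 0.
Proof. by move=> fl l0; exact: (@cvgr_neq0 R R^o _ _ _ f l fl l0). Qed.

Lemma cvgr_sum (I : Type) (r : seq I) (f : I -> T -> R) (l : I -> R) :
  (forall i, f i t @[t --> F] --> l i) ->
  (\sum_(i <- r) f i t) @[t --> F] --> \sum_(i <- r) l i.
Proof.
move=> fl; elim: r => [|i r IH].
  by rewrite big_nil; under eq_fun do rewrite big_nil; exact: cvg_cst.
by rewrite big_cons; under eq_fun do rewrite big_cons; exact: cvgD.
Qed.

Lemma cvgr_prod (I : Type) (r : seq I) (f : I -> T -> R) (l : I -> R) :
  (forall i, f i t @[t --> F] --> l i) ->
  (\prod_(i <- r) f i t) @[t --> F] --> \prod_(i <- r) l i.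
Proof.
move=> fl; elim: r => [|i r IH].
  by rewrite big_nil; under eq_fun do rewrite big_nil; exact: cvg_cst.
by rewrite big_cons; under eq_fun do rewrite big_cons; exact: cvgM.
Qed.

Lemma cvgr_exp (f : T -> R) (l : R) k : f t @[t --> F] --> l ->
  f t ^+ k @[t --> F] --> l ^+ k.
Proof.
move=> fl; elim: k => [|k IH].
  by rewrite expr0; under eq_fun do rewrite expr0; exact: cvg_cst.
by rewrite exprS; under eq_fun do rewrite exprS; exact: cvgM.
Qed.

Definition mx_cvg m n (A : T -> 'M[R]_(m, n)) (L : 'M[R]_(m, n)) : Prop :=
  forall i j, A t i j @[t --> F] --> L i j.

Lemma mx_cvg_mul m n p (A : T -> 'M[R]_(m, n)) (B : T -> 'M[R]_(n, p)) LA LB :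
  mx_cvg A LA -> mx_cvg B LB -> mx_cvg (fun t => A t *m B t) (LA *m LB).
Proof.
move=> cA cB i j; rewrite mxE; under eq_fun do rewrite mxE.
by apply: cvgr_sum => k; exact: cvgM.
Qed.

Lemma cvg_mxtrace n (A : T -> 'M[R]_n) L :
  mx_cvg A L -> \tr (A t) @[t --> F] --> \tr L.
Proof. by move=> cA; exact: cvgr_sum. Qed.

Lemma cvg_sqnorm m n (A : T -> 'M[R]_(m, n)) L :
  mx_cvg A L -> sqnorm (A t) @[t --> F] --> sqnorm L.
Proof.
by move=> cA; apply: cvgr_sum => i; apply: cvgr_sum => j; exact: cvgr_exp.
Qed.

Lemma cvg_det n (A : T -> 'M[R]_n) L :
  mx_cvg A L -> \det (A t) @[t --> F] --> \det L.
Proof.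
move=> cA; apply: cvgr_sum => s; apply: cvgM; first exact: cvg_cst.
by apply: cvgr_prod => i.
Qed.

Lemma mx_cvg_inv n (A : T -> 'M[R]_n) L : L \in unitmx ->
  mx_cvg A L -> mx_cvg (fun t => invmx (A t)) (invmx L).
Proof.
move=> uL cA i j; have d0 : \det L != 0 by move: uL; rewrite unitmxE unitfE.
rewrite /invmx uL !mxE.
have near_inv : \forall t \near F,
    (\det (A t))^-1 * cofactor (A t) j i = (invmx (A t)) i j.
  have := near_neq0 (cvg_det cA) d0; apply: filterS => t dt.
  by rewrite /invmx unitmxE unitfE dt !mxE.
apply: cvg_trans (near_eq_cvg near_inv) _.
apply: cvgM; first by apply: cvgV => //; exact: cvg_det.
apply: cvgM; first exact: cvg_cst.
apply: cvg_det => k l; rewrite !mxE; under eq_fun do rewrite !mxE.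
exact: cA.
Qed.

Lemma cvg_metric_sqnorm n (A h : T -> 'M[R]_n) LA Lh : LA \in unitmx ->
  mx_cvg A LA -> mx_cvg h Lh ->
  metric_sqnorm (A t) (h t) @[t --> F] --> metric_sqnorm LA Lh.
Proof.
move=> uA cA ch; apply: cvg_mxtrace.
apply: mx_cvg_mul => //; apply: mx_cvg_mul; last exact: mx_cvg_inv.
by apply: mx_cvg_mul => //; exact: mx_cvg_inv.
Qed.

Lemma cvg_sqrt (f : T -> R) (l : R) : f t @[t --> F] --> l ->
  Num.sqrt (f t) @[t --> F] --> Num.sqrt l.
Proof. by move=> fl; apply: continuous_cvg fl; exact: sqrt_continuous. Qed.

(** The calculus of difference quotients r (u1 - u0) along a filter.  With
    r = 1/(s - t) and u1, u0 the values at (s, y) and (t, y), the filter of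
    s -> t and y -> y0 gives derivatives in t that are locally uniform in y. *)
Definition quot_cvg (r u0 u1 : T -> R) (l l' : R) : Prop :=
  [/\ u0 t @[t --> F] --> l, u1 t @[t --> F] --> l &
      r t * (u1 t - u0 t) @[t --> F] --> l'].

Lemma quot_cvg_cst r c : quot_cvg r (fun=> c) (fun=> c) c 0.
Proof.
split; [exact: cvg_cst|exact: cvg_cst|].
by under eq_fun do rewrite subrr mulr0; exact: cvg_cst.
Qed.

Lemma quot_cvgD r u0 u1 v0 v1 l l' k k' :
  quot_cvg r u0 u1 l l' -> quot_cvg r v0 v1 k k' ->
  quot_cvg r (fun t => u0 t + v0 t) (fun t => u1 t + v1 t) (l + k) (l' + k').
Proof.
move=> [u0l u1l ul] [v0l v1l vl]; split; [exact: cvgD|exact: cvgD|].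
rewrite [X in X @ _](_ : _ = fun t => r t * (u1 t - u0 t) + r t * (v1 t - v0 t)).
  exact: cvgD.
by apply/funext => t; ring.
Qed.

Lemma quot_cvgM r u0 u1 v0 v1 l l' k k' :
  quot_cvg r u0 u1 l l' -> quot_cvg r v0 v1 k k' ->
  quot_cvg r (fun t => u0 t * v0 t) (fun t => u1 t * v1 t)
    (l * k) (l' * k + l * k').
Proof.
move=> [u0l u1l ul] [v0l v1l vl]; split; [exact: cvgM|exact: cvgM|].
rewrite [X in X @ _](_ : _ =
    fun t => r t * (u1 t - u0 t) * v1 t + u0 t * (r t * (v1 t - v0 t))).
  by apply: cvgD; exact: cvgM.
by apply/funext => t; ring.
Qed.

Lemma quot_cvgV r u0 u1 l l' : l != 0 -> quot_cvg r u0 u1 l l' ->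
  quot_cvg r (fun t => (u0 t)^-1) (fun t => (u1 t)^-1) l^-1 (- (l^-1 ^+ 2 * l')).
Proof.
move=> l0 [u0l u1l ul]; split; [exact: cvgV|exact: cvgV|].
have near_quot : \forall t \near F,
    - ((u0 t)^-1 * (u1 t)^-1 * (r t * (u1 t - u0 t))) =
    r t * ((u1 t)^-1 - (u0 t)^-1).
  near=> t.
  have a0 : u0 t != 0 by near: t; exact: near_neq0 u0l l0.
  have b0 : u1 t != 0 by near: t; exact: near_neq0 u1l l0.
  by field; rewrite a0 b0.
apply: cvg_trans (near_eq_cvg near_quot) _.
by apply: cvgN; rewrite expr2; apply: cvgM => //; apply: cvgM; exact: cvgV.
Unshelve. all: by end_near. Qed.

Lemma quot_cvgX r u0 u1 l l' k : quot_cvg r u0 u1 l l' ->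
  quot_cvg r (fun t => u0 t ^+ k) (fun t => u1 t ^+ k) (l ^+ k)
    (k%:R * l ^+ k.-1 * l').
Proof.
move=> ul; elim: k => [|k IH].
  by rewrite !mul0r; exact: quot_cvg_cst.
have expS u : (fun t => u t ^+ k.+1) = (fun t : T => u t * u t ^+ k :> R).
  by apply/funext => t; rewrite exprS.
rewrite !expS exprS; have := quot_cvgM ul IH.
rewrite [X in quot_cvg _ _ _ _ X](_ : _ = k.+1%:R * l ^+ k.+1.-1 * l')//=.
by case: k {IH expS} => [|k] /=; rewrite ?expr0 ?exprS -[in RHS]natr1; ring.
Qed.

Lemma quot_cvg_sum r n (u0 u1 : 'I_n -> T -> R) l l' :
  (forall i, quot_cvg r (u0 i) (u1 i) (l i) (l' i)) ->
  quot_cvg r (fun t => \sum_i u0 i t) (fun t => \sum_i u1 i t)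
    (\sum_i l i) (\sum_i l' i).
Proof.
move=> ul; split.
- by apply: cvgr_sum => i; case: (ul i).
- by apply: cvgr_sum => i; case: (ul i).
- under eq_fun do rewrite -sumrB mulr_sumr.
  by apply: cvgr_sum => i; case: (ul i).
Qed.

Definition mx_quot_cvg n r (A0 A1 : T -> 'M[R]_n) (L L' : 'M[R]_n) : Prop :=
  forall i j, quot_cvg r (fun t => A0 t i j) (fun t => A1 t i j) (L i j) (L' i j).

Lemma quot_cvg_mxtrace n r (A0 A1 : T -> 'M[R]_n) L L' :
  mx_quot_cvg r A0 A1 L L' ->
  quot_cvg r (fun t => \tr (A0 t)) (fun t => \tr (A1 t)) (\tr L) (\tr L').
Proof. by move=> AL; exact: quot_cvg_sum. Qed.

(** A1^-1 - A0^-1 = - A1^-1 (A1 - A0) A0^-1. *)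
Lemma mx_quot_cvg_inv n r (A0 A1 : T -> 'M[R]_n) L L' : L \in unitmx ->
  mx_quot_cvg r A0 A1 L L' ->
  mx_quot_cvg r (fun t => invmx (A0 t)) (fun t => invmx (A1 t))
    (invmx L) (- (invmx L *m L' *m invmx L)).
Proof.
move=> uL AL.
have c0 : mx_cvg A0 L by move=> k l; case: (AL k l).
have c1 : mx_cvg A1 L by move=> k l; case: (AL k l).
have i0 := mx_cvg_inv uL c0; have i1 := mx_cvg_inv uL c1.
have d0 : \det L != 0 by move: uL; rewrite unitmxE unitfE.
move=> i j; split; [exact: i0|exact: i1|].
have cq : mx_cvg (fun t => r t *: (A1 t - A0 t)) L'.
  by move=> k l; under eq_fun do rewrite !mxE; case: (AL k l).
have near_quot : \forall t \near F,
    - (invmx (A1 t) *m (r t *: (A1 t - A0 t)) *m invmx (A0 t)) i j =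
    r t * ((invmx (A1 t)) i j - (invmx (A0 t)) i j).
  near=> t.
  have u0 : A0 t \in unitmx.
    by rewrite unitmxE unitfE; near: t; exact: near_neq0 (cvg_det c0) d0.
  have u1 : A1 t \in unitmx.
    by rewrite unitmxE unitfE; near: t; exact: near_neq0 (cvg_det c1) d0.
  rewrite -scalemxAr -scalemxAl mulmxBr mulmxBl mulVmx// mul1mx mulmxK//.
  by rewrite !mxE; ring.
apply: cvg_trans (near_eq_cvg near_quot) _.
rewrite mxE; apply: cvgN.
by apply: mx_cvg_mul => //; exact: mx_cvg_mul.
Unshelve. all: by end_near. Qed.

End limits_along_a_filter.

(** * Damped observables of a positive definite matrix *)

(** The square of the Lipschitz constant of the observables below. *)
Definition lipschitz_const {R : realType} (n : nat) : R :=
  (n.+1 * n ^ 3 + n ^ 2)%:R ^+ 2 * (n`!)%:R.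

Section observables.
Context {R : realType} {n : nat}.
Implicit Types (A B h : 'M[R]_n) (o : option ('I_n * 'I_n)).

(** Large exactly when A is large or close to a degenerate matrix. *)
Definition distortion A : R := 1 + \tr A + \tr (invmx A).

(** The differential of the distortion, by d(A^-1) = - A^-1 h A^-1; those of
    the damping and of the observables follow from it. *)
Definition d_distortion A h : R := \tr h - \tr (invmx A *m h *m invmx A).

(** The exponent is chosen for [sqr_d_observable_le]: an entry of A, and its
    differential, cost one factor T = distortion A, while sqrt (det A) is
    bounded below by T^-n / n!; and T^-(n+1) T = T^-n has square at most T^-n. *)
Definition damping A : R := (distortion A)^-1 ^+ n.+1.

Definition d_damping A h : R :=
  - (n.+1%:R * (distortion A)^-1 ^+ n.+2 * d_distortion A h).

(** The index None gives the damping alone, by which the damped entry of index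
    Some (i, j) can be divided to recover A i j. *)
Definition observable o A : R :=
  damping A * (if o is Some ij then A ij.1 ij.2 else 1).

Definition d_observable o A h : R :=
  d_damping A h * (if o is Some ij then A ij.1 ij.2 else 1) +
  damping A * (if o is Some ij then h ij.1 ij.2 else 0).

Section bounds.
Variable A : 'M[R]_n.
Hypothesis pA : posdef A.

Lemma distortion_ge1 : 1 <= distortion A.
Proof.
rewrite /distortion -addrA lerDl addr_ge0// posdef_tr_ge0//.
exact: posdef_inv.
Qed.

Lemma distortion_gt0 : 0 < distortion A.
Proof. exact: lt_le_trans distortion_ge1. Qed.

Lemma tr_le_distortion : \tr A <= distortion A.
Proof.
have := posdef_tr_ge0 (posdef_inv pA); rewrite /distortion; lra.
Qed.

Lemma tr_inv_le_distortion : \tr (invmx A) <= distortion A.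
Proof. by have := posdef_tr_ge0 pA; rewrite /distortion; lra. Qed.

Lemma det_le_distortion : \det A <= (n`!)%:R * distortion A ^+ n.
Proof.
apply: (le_trans (posdef_det_le pA)); rewrite ler_wpM2l//.
by rewrite lerXn2r// ?nnegrE ?posdef_tr_ge0 ?(ltW distortion_gt0)//
  tr_le_distortion.
Qed.

Lemma det_ge_distortion : ((n`!)%:R * distortion A ^+ n)^-1 <= \det A.
Proof.
have d0 := posdef_det_gt0 pA.
rewrite invf_ple ?posrE// -?det_inv.
- apply: (le_trans (posdef_det_le (posdef_inv pA))); rewrite ler_wpM2l//.
  have i0 := posdef_tr_ge0 (posdef_inv pA).
  by rewrite lerXn2r// ?nnegrE ?(ltW distortion_gt0)// tr_inv_le_distortion.
- by rewrite mulr_gt0// ?ltr0n ?fact_gt0// exprn_gt0// distortion_gt0.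
Qed.

Lemma sqrt_det_ge_distortion :
  ((n`!)%:R * distortion A ^+ n)^-1 <= Num.sqrt (\det A).
Proof.
have x1 : 1 <= (n`!)%:R * distortion A ^+ n.
  by rewrite mulr_ege1 ?ler1n ?fact_gt0// exprn_ege1// distortion_ge1.
have := det_ge_distortion; set x := _ * _ in x1 * => xd.
have x0 : 0 < x by exact: lt_le_trans x1.
have ix0 : 0 <= x^-1 by rewrite invr_ge0 ltW.
rewrite -[x^-1]ger0_norm// -sqrtr_sqr; apply: ler_wsqrtr.
by apply: le_trans xd; rewrite expr2 ler_piMr// invf_le1.
Qed.

Lemma sqrt_det_le_distortion :
  Num.sqrt (\det A) <= (n`!)%:R * distortion A ^+ n.
Proof.
have x1 : 1 <= (n`!)%:R * distortion A ^+ n.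
  by rewrite mulr_ege1 ?ler1n ?fact_gt0// exprn_ege1// distortion_ge1.
have := det_le_distortion; set x := _ * _ in x1 * => dx.
have x0 : 0 <= x by exact: le_trans x1.
rewrite -[x]ger0_norm// -sqrtr_sqr; apply: ler_wsqrtr.
by apply: (le_trans dx); rewrite expr2 ler_peMr.
Qed.

Lemma damping_gt0 : 0 < damping A.
Proof. by rewrite exprn_gt0// invr_gt0 distortion_gt0. Qed.

Lemma entry_le_distortion i j : `|A i j| <= distortion A.
Proof. exact: le_trans (posdef_entry_le i j pA) tr_le_distortion. Qed.

Lemma d_distortion_le h : h^T = h ->
  `|d_distortion A h| <=
    (n ^ 3)%:R * distortion A * Num.sqrt (metric_sqnorm A h).
Proof.
move=> sh; set k := Num.sqrt _; have k0 : 0 <= k by exact: sqrtr_ge0.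
have trn (X : 'M[R]_n) (c : R) : (forall i, `|X i i| <= c) -> `|\tr X| <= n%:R * c.
  move=> Xc; apply: (le_trans (ler_norm_sum _ _ _)).
  apply: (@le_trans _ _ (\sum_(i < n) c)); first exact: ler_sum.
  by rewrite sumr_const card_ord mulr_natl.
have h1 := trn h _ (fun i => entry_le_metric i i pA sh).
have h2 := trn _ _ (fun i => inv_entry_le_metric i i pA sh).
apply: (le_trans (ler_normB _ _)); apply: (le_trans (lerD h1 h2)).
rewrite [leLHS](_ : _ = (n ^ 3)%:R * (\tr A + \tr (invmx A)) * k).
  by rewrite ler_wpM2r// ler_wpM2l// /distortion; lra.
by rewrite expnS natrM -/k; ring.
Qed.

Lemma d_observable_le o h : h^T = h ->
  `|d_observable o A h| <=
    (n.+1 * n ^ 3 + n ^ 2)%:R * (distortion A)^-1 ^+ n *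
      Num.sqrt (metric_sqnorm A h).
Proof.
move=> sh; set k := Num.sqrt _; have k0 : 0 <= k by exact: sqrtr_ge0.
have T1 := distortion_ge1; have T0 := distortion_gt0.
have dT := d_distortion_le sh; rewrite -/k in dT.
have hk ij : `|h ij.1 ij.2| <= (n ^ 2)%:R * distortion A * k.
  apply: (le_trans (entry_le_metric _ _ pA sh)).
  by rewrite -/k !ler_wpM2r// ler_wpM2l// tr_le_distortion.
rewrite /d_observable; apply: (le_trans (ler_normD _ _)).
set T := distortion A in T1 T0 dT hk *; set q := (T^-1) ^+ n.
have q0 : 0 <= q by rewrite exprn_ge0// invr_ge0 ltW.
have qS : damping A = q / T by rewrite /damping exprSr.
have TV : T^-1 * T = 1 by rewrite mulVf ?gt_eqF.
have qT : q / T * T = q by rewrite -mulrA TV mulr1.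
have dd : `|d_damping A h| <= n.+1%:R * (n ^ 3)%:R * (q / T) * k.
  rewrite normrN normrM (_ : n.+1%:R * _ = n.+1%:R * (q / T / T)); last first.
    by rewrite /q !exprSr.
  have c0 : 0 <= n.+1%:R * (q / T / T) by rewrite mulr_ge0// !divr_ge0// ltW.
  rewrite ger0_norm//; apply: (le_trans (ler_wpM2l c0 dT)).
  rewrite le_eqVlt; apply/orP; left; apply/eqP.
  by rewrite -[in RHS](mulr1 q) -TV; ring.
have qT0 : 0 <= q / T by rewrite divr_ge0// ltW.
have w1 : `|if o is Some ij then A ij.1 ij.2 else 1| <= T.
  by case: (o) => [ij|]; [exact: entry_le_distortion|rewrite normr1].
have w2 : `|if o is Some ij then h ij.1 ij.2 else 0| <= (n ^ 2)%:R * T * k.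
  by case: (o) => [ij|]; [exact: hk|rewrite normr0 !mulr_ge0// ltW].
rewrite !normrM qS [`|q / T|]ger0_norm// natrD natrM !mulrDl lerD//.
  apply: (le_trans (ler_pM _ _ dd w1)) => //.
  by rewrite -[in leRHS]qT le_eqVlt; apply/orP; left; apply/eqP; ring.
apply: (le_trans (ler_wpM2l qT0 w2)).
by rewrite -[in leRHS]qT le_eqVlt; apply/orP; left; apply/eqP; ring.
Qed.

(** The damping makes each observable Lipschitz for the pointwise L2 metric on
    the whole cone of positive definite matrices, however degenerate or large
    the matrix: this controls the paths that leave the amenable set. *)
Lemma sqr_d_observable_le o h : h^T = h ->
  d_observable o A h ^+ 2 <=
    lipschitz_const n * energy_density A h.
Proof.
move=> sh; have := d_observable_le o sh; rewrite /lipschitz_const.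
rewrite /energy_density; set D := _%:R; set k := Num.sqrt _ => dk.
have k2 : metric_sqnorm A h = k ^+ 2 by rewrite sqr_sqrtr// metric_sqnorm_ge0.
have T1 := distortion_ge1; have T0 := distortion_gt0.
set q := (distortion A)^-1 ^+ n in dk.
have iT0 : 0 <= (distortion A)^-1 by rewrite invr_ge0 ltW.
have q0 : 0 <= q by rewrite exprn_ge0.
have q1 : q <= 1 by rewrite exprn_ile1// invf_le1.
have qs : q <= (n`!)%:R * Num.sqrt (\det A).
  have := sqrt_det_ge_distortion; rewrite invfM -exprVn -/q => qs.
  by rewrite mulrC -ler_pdivrMr ?ltr0n ?fact_gt0// mulrC.
have q2 : q ^+ 2 <= (n`!)%:R * Num.sqrt (\det A).
  by apply: le_trans qs; rewrite expr2 ler_piMr.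
rewrite -real_normK ?num_real//; apply: (@le_trans _ _ ((D * q * k) ^+ 2)).
  by rewrite lerXn2r// nnegrE (le_trans _ dk).
rewrite k2 [leLHS](_ : _ = D ^+ 2 * k ^+ 2 * q ^+ 2); last by ring.
rewrite [leRHS](_ : _ = D ^+ 2 * k ^+ 2 * ((n`!)%:R * Num.sqrt (\det A))).
  by rewrite ler_wpM2l// mulr_ge0// sqr_ge0.
by ring.
Qed.


End bounds.

(** On matrices of bounded distortion the damping is bounded below, so that the
    entries are Lipschitz functions of the observables. *)
Lemma sqnorm_sub_le_observable A B t : posdef A -> posdef B ->
  distortion A <= t -> distortion B <= t ->
  sqnorm (B - A) <= 2 * (n * n)%:R * t ^+ (2 * n.+2) *
    \sum_o (observable o B - observable o A) ^+ 2.
Proof.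
move=> pA pB At Bt; set s := \sum_o _.
have t1 : 1 <= t by exact: le_trans (distortion_ge1 pA) At.
have t0 : 0 <= t by exact: le_trans t1.
have s0 : 0 <= s by apply: sumr_ge0 => o _; exact: sqr_ge0.
have entry i j : `|(B - A) i j| <= Num.sqrt (2 * t ^+ (2 * n.+2) * s).
  have a0 := damping_gt0 pA.
  set x := observable (Some (i, j)) B - observable (Some (i, j)) A.
  set y := observable None B - observable None A.
  have -> : (B - A) i j = (damping A)^-1 * (x - B i j * y).
    by rewrite !mxE /x /y /observable /=; field; rewrite gt_eqF.
  rewrite -sqrtr_sqr ler_wsqrtr// exprMn.
  have ia : ((damping A)^-1) ^+ 2 <= t ^+ (2 * n.+1).
    rewrite /damping -exprVn invrK -exprM mulnC.
    by rewrite lerXn2r ?nnegrE// ltW// distortion_gt0.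
  have xy : (x - B i j * y) ^+ 2 <= 2 * t ^+ 2 * s.
    have xys : x ^+ 2 + y ^+ 2 <= s.
      rewrite /s (bigD1 (Some (i, j)))//= (bigD1 None)//= addrA lerDl.
      by apply: sumr_ge0 => o _; exact: sqr_ge0.
    have b2 : B i j ^+ 2 <= t ^+ 2.
      rewrite -[B i j ^+ 2]real_normK ?num_real// lerXn2r ?nnegrE//.
      exact: le_trans (entry_le_distortion pB i j) Bt.
    have t2 : 1 <= t ^+ 2 by exact: exprn_ege1.
    have h1 : (x - B i j * y) ^+ 2 <= 2 * (x ^+ 2 + B i j ^+ 2 * y ^+ 2).
      by have := sqr_ge0 (x + B i j * y); nra.
    apply: (le_trans h1); rewrite -mulrA ler_wpM2l//.
    apply: (@le_trans _ _ (t ^+ 2 * (x ^+ 2 + y ^+ 2))).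
      rewrite mulrDr lerD//; first by rewrite ler_peMl// sqr_ge0.
      by rewrite ler_wpM2r// sqr_ge0.
    by rewrite ler_wpM2l// exprn_ge0.
  apply: (le_trans (ler_pM (sqr_ge0 _) (sqr_ge0 _) ia xy)).
  by rewrite [(2 * n.+2)%N]mulnS exprD le_eqVlt; apply/orP; left; apply/eqP; ring.
apply: (le_trans (sqnorm_le entry)).
rewrite sqr_sqrtr; last by rewrite mulr_ge0// mulr_ge0// exprn_ge0.
by rewrite le_eqVlt; apply/orP; left; apply/eqP; ring.
Qed.

Section limits.
Context {T : Type} (F : set_system T) {FF : Filter F}.

Lemma cvg_distortion (A : T -> 'M[R]_n) L : L \in unitmx -> mx_cvg F A L ->
  distortion (A t) @[t --> F] --> distortion L.
Proof.
move=> uL cA; apply: cvgD; last by apply: cvg_mxtrace; exact: mx_cvg_inv.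
by apply: cvgD; [exact: cvg_cst|exact: cvg_mxtrace].
Qed.

Lemma quot_cvg_observable o r (A0 A1 : T -> 'M[R]_n) L L' :
  posdef L -> mx_quot_cvg F r A0 A1 L L' ->
  quot_cvg F r (fun t => observable o (A0 t)) (fun t => observable o (A1 t))
    (observable o L) (d_observable o L L').
Proof.
move=> pL AL; have uL := posdef_unit pL.
have T0 : distortion L != 0.
  by apply: lt0r_neq0; exact: distortion_gt0.
have dT : quot_cvg F r (fun t => distortion (A0 t)) (fun t => distortion (A1 t))
    (distortion L) (d_distortion L L').
  have -> : d_distortion L L' = 0 + \tr L' + \tr (- (invmx L *m L' *m invmx L)).
    by rewrite add0r raddfN.
  apply: quot_cvgD; last by apply: quot_cvg_mxtrace; exact: mx_quot_cvg_inv.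
  by apply: quot_cvgD; [exact: quot_cvg_cst|exact: quot_cvg_mxtrace].
have ddamp : quot_cvg F r (fun t => damping (A0 t)) (fun t => damping (A1 t))
    (damping L) (d_damping L L').
  have -> : d_damping L L' = n.+1%:R * (distortion L)^-1 ^+ n.+1.-1 *
      - ((distortion L)^-1 ^+ 2 * d_distortion L L').
    by rewrite /d_damping/= [n.+2]lock -lock -[n.+2]addn2 exprD; ring.
  by apply: quot_cvgX; exact: quot_cvgV.
rewrite /d_observable; apply: quot_cvgM => //.
by case: o => [[i j]|]; [exact: AL|exact: quot_cvg_cst].
Qed.

End limits.

End observables.

(** * Integration over coordinate domains *)

Section lebesgue_on_coordinates.
Context {R : realType}.
Local Notation T := (measurableTypeR R).

(** An open set is a countable union of cubes with rational centres, and cubes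
    belong to the product sigma-algebra. *)
Lemma measurable_preimage_rV_open n (O : set 'rV[R]_n) : open O ->
  measurable (@rV_of_tuple R n @^-1` O).
Proof.
move=> oO.
pose box (c : 'rV[rat]_n) (k : nat) : set (n.-tuple T) :=
  [set t | forall i, `|ratr (c 0 i) - tnth t i| < k.+1%:R^-1].
pose inO (p : 'rV[rat]_n * nat) := box p.1 p.2 `<=` @rV_of_tuple R n @^-1` O.
(* the rational cubes inside O, enumerated through the countable type of their
   centres and sizes *)
pose F k := if unpickle k is Some p then
  (if `[< inO p >] then box p.1 p.2 else set0) else set0.
have -> : @rV_of_tuple R n @^-1` O = \bigcup_k F k.
  apply/seteqP; split => [t Ot|t [k _]]; last first.
    by rewrite /F; case: unpickle => // p; case: asboolP => // pO /pO.
  have /nbhs_ballP[e e0 eO] := open_nbhs_nbhs (conj oO Ot).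
  have [k ke] : exists k : nat, k.+1%:R^-1 < e / 2.
    have /ltr_add_invr[k] : 0 < e / 2 by rewrite divr_gt0.
    by rewrite add0r => ?; exists k.
  have k0 : 0 < k.+1%:R^-1 :> R by rewrite invr_gt0.
  have /choice[c cP] : forall i, exists q : rat, `|ratr q - tnth t i| < k.+1%:R^-1.
    move=> i; set x : R := tnth t i; set d := _^-1 in k0 *.
    have : x - d < x + d by lra.
    move=> /rat_in_itvoo[q]; rewrite in_itv/= => /andP[q1 q2]; exists q.
    by rewrite ltr_norml; apply/andP; split; lra.
  have tc : box (\row_i c i) k t by move=> i; rewrite mxE.
  exists (pickle (\row_i c i, k)) => //; rewrite /F pickleK.
  case: asboolP => // -[] s /= sb; apply: eO; split=> // i j.
  rewrite /ball/= /rV_of_tuple !mxE.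
  have := sb j; have := tc j; rewrite mxE => h1 h2.
  set x : R := tnth t j in h1 *; set y : R := tnth s j in h2 *.
  have -> : x - y = (ratr (c j) - y) - (ratr (c j) - x) by ring.
  apply: (le_lt_trans (ler_normB _ _)).
  by rewrite [e]splitr ltrD// ?(lt_trans h1 ke) ?(lt_trans h2 ke).
apply: bigcupT_measurable => k; rewrite /F; case: unpickle => // p.
case: asboolP => // _.
rewrite (_ : box _ _ = \bigcap_(i in [set: 'I_n])
    ((@tnth n T)^~ i) @^-1` ball (ratr (p.1 0 i) : R) (p.2.+1%:R^-1)); last first.
  by apply/seteqP; split => [t tb i _|t tb i]; [exact: tb|exact: (tb i)].
apply: fin_bigcap_measurable => // i _.
rewrite -[X in measurable X]setTI; apply: measurable_tnth => //.
by rewrite ball_itv; exact: measurable_itv.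
Qed.

Definition cube n (r : R) : set (n.-tuple T) :=
  [set t | forall i, `|(tnth t i : R)| <= r].

Arguments cube : clear implicits.

Lemma measurable_cube n r : measurable (cube n r).
Proof.
rewrite (_ : cube n r = \bigcap_(i in [set: 'I_n])
    ((@tnth n T)^~ i) @^-1` `[- r, r]%classic); last first.
  apply/seteqP; split => [t tb i _|t tb i] /=.
    by rewrite in_itv/= -ler_norml; exact: tb.
  by have := tb i Logic.I; rewrite /= in_itv/= -ler_norml.
apply: fin_bigcap_measurable => // i _.
by rewrite -[X in measurable X]setTI; apply: measurable_tnth => //;
  exact: measurable_itv.
Qed.

Lemma lebesgue_tuple_cube_fin n r : (lebesgue_tuple n (cube n r) < +oo)%E.
Proof.
elim: n => [|n IH].
  by rewrite /= diracE; case: (_ \in _) => /=; rewrite ltry.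
rewrite /= /lebesgue_cons /pushforward.
rewrite (_ : _ @^-1` _ = `[- r, r]%classic `*` cube n r); last first.
  apply/seteqP; split => [[x t] /= xt|[x t] /= [xr tr] i].
    split; first by rewrite in_itv/= -ler_norml; have := xt ord0; rewrite tnth0.
    by move=> i; have := xt (lift ord0 i); rewrite tnthS.
  case: (unliftP ord0 i) => [j ->|->]; first by rewrite tnthS; exact: tr.
  by move: xr; rewrite tnth0 in_itv/= -ler_norml.
rewrite [X in (X < _)%E]product_measure1E//=; last exact: measurable_cube.
rewrite lte_mul_pinfty//.
  by rewrite ge0_fin_numE// lebesgue_measure_itv; case: ifP => // _; exact: ltry.
Qed.

End lebesgue_on_coordinates.

(** The coordinate integrals are taken over a Borel set Om of coordinates that
    stays in a compact part Kc of the range O of a chart, so that all functions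
    continuous on O are integrable over Om. *)
Definition integration_domain {R : realType} n (O Kc Om : set 'rV[R]_n) : Prop :=
  [/\ open O, compact Kc, Kc `<=` O, Om `<=` Kc &
    measurable (@rV_of_tuple R n @^-1` Om)].

Section coordinate_integral.
Context {R : realType} {n : nat} (O Kc Om : set 'rV[R]_n).
Hypothesis dom : integration_domain O Kc Om.
Implicit Types f h : 'rV[R]_n -> R.
Local Notation mu := (@lebesgue_tuple R n).
Local Notation X := (@rV_of_tuple R n @^-1` Om).

Lemma continuous_bounded_on_compact f : {in O, continuous f} ->
  exists2 c, 0 < c & forall y, Kc y -> `|f y| <= c.
Proof.
case: dom => oO cK KO OmK mOm cf.
have /continuous_compact/(_ cK)/compact_bounded[c [_ cP]] :
    {within Kc, continuous f}.
  by apply: continuous_in_subspaceT => y /set_mem Ky; apply: cf; exact/mem_set/KO.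
exists (`|c| + 1) => [|y Ky]; first by rewrite ltr_wpDl.
apply: (cP (`|c| + 1)); last by exists y.
by rewrite (le_lt_trans (ler_norm c))// ltrDl.
Qed.

Lemma domain_measure_fin : (mu X < +oo)%E.
Proof.
case: dom => oO cK KO OmK mOm.
have [M [_ MP]] := compact_bounded cK.
pose r : R := `|M| + 1.
have sub : X `<=` @cube R n r.
  move=> t /OmK Kt i.
  have := MP r _ _ Kt; rewrite /r (le_lt_trans (ler_norm M)) ?ltrDl// => /(_ isT).
  apply: le_trans; rewrite [leRHS]/Num.norm/= mx_normrE.
  by rewrite (le_trans _ (le_bigmax _ _ (0, i)))//= mxE.
apply: (le_lt_trans (le_measure _ _ _ sub)) (lebesgue_tuple_cube_fin n r).
- by rewrite inE.
- by rewrite inE; exact: measurable_cube.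
Qed.

Lemma integrable_continuous f : {in O, continuous f} ->
  mu.-integrable X (EFin \o (f \o @rV_of_tuple R n)).
Proof.
move=> cf; have [c c0 fc] := continuous_bounded_on_compact cf.
case: (dom) => oO cK KO OmK mOm.
apply: measurable_bounded_integrable => //; first exact: domain_measure_fin.
- apply: (measurability _ (RGenOpens.measurableE R)) => _ [_ [a [b ->] <-]].
  rewrite (_ : _ `&` _ = X `&` @rV_of_tuple R n @^-1` (O `&` f @^-1` `]a, b[)).
    apply: measurableI => //; apply: measurable_preimage_rV_open.
    rewrite openE => y [Oy fy]; apply: filterI; first exact: open_nbhs_nbhs.
    apply: (cf y (mem_set Oy)); apply: open_nbhs_nbhs; split => //.
  apply/seteqP; split => [t [Xt ft]|t [Xt [_ ft]]]; split => //; split => //.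
  exact/KO/OmK.
- exists c; split; first exact: num_real.
  by move=> x cx t /OmK Kt; rewrite /= (le_trans (fc _ Kt))// ltW.
Qed.

Lemma integral_rVD f h : {in O, continuous f} -> {in O, continuous h} ->
  integral_rV Om (fun y => f y + h y) = integral_rV Om f + integral_rV Om h.
Proof.
move=> cf ch; case: (dom) => oO cK KO OmK mOm.
by rewrite /integral_rV RintegralD//; exact: integrable_continuous.
Qed.

Lemma integral_rVZ f k : {in O, continuous f} ->
  integral_rV Om (fun y => k * f y) = k * integral_rV Om f.
Proof.
move=> cf; case: (dom) => oO cK KO OmK mOm.
by rewrite /integral_rV RintegralZl//; exact: integrable_continuous.
Qed.

Lemma le_integral_rV f h : {in O, continuous f} -> {in O, continuous h} ->
  (forall y, Om y -> f y <= h y) -> integral_rV Om f <= integral_rV Om h.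
Proof.
move=> cf ch fh; case: (dom) => oO cK KO OmK mOm.
by rewrite /integral_rV le_Rintegral//; first [exact: integrable_continuous|
  move=> t; exact: fh].
Qed.

Lemma integral_rV_ge0 f : (forall y, Om y -> 0 <= f y) -> 0 <= integral_rV Om f.
Proof. by move=> f0; apply: Rintegral_ge0 => t; exact: f0. Qed.

Lemma eq_integral_rV f h : (forall y, Om y -> f y = h y) ->
  integral_rV Om f = integral_rV Om h.
Proof. by move=> fh; apply: eq_Rintegral => t /set_mem; exact: fh. Qed.

End coordinate_integral.

(** * An inequality of mean value type *)

(** I minus the primitive of N has nonpositive derivative inside the interval
    and is continuous up to its ends. *)
Lemma increment_le_integral {R : realType} (I D N : R -> R) (a b : R) : a < b ->
  (forall t, t \in `[a, b] -> N s @[s --> within `[a, b] (nbhs t)] --> N t) ->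
  (forall t, t \in `[a, b] ->
    (s - t)^-1 * (I s - I t) @[s --> within `[a, b] t^'] --> D t) ->
  (forall t, t \in `[a, b] -> D t <= N t) ->
  I b - I a <= \int[lebesgue_measure]_(t in `[a, b]) N t.
Proof.
move=> ab cN dI DN.
have wN : {within `[a, b], continuous N}.
  by apply/subspace_continuousP => t tab; exact: cN.
have iN : lebesgue_measure.-integrable `[a, b] (EFin \o N).
  by apply: continuous_compact_integrable => //; exact: segment_compact.
pose P x := \int[lebesgue_measure]_(t in `[a, x]) N t.
have wP : {within `[a, b], continuous P}.
  exact: parameterized_integral_continuous (ltW ab) iN.
have inner t : t \in `]a, b[ -> \forall s \near t, s \in `[a, b].
  move=> tab; have : nbhs t `]a, b[%classic by apply: open_nbhs_nbhs; split.
  by apply: filterS => s /=; exact: subset_itv_oo_cc.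
have occ t : t \in `]a, b[ -> t \in `[a, b] by exact: subset_itv_oo_cc.
have dP t : t \in `]a, b[ -> is_derive t 1 P (N t).
  move=> tab; have [] := @continuous_FTC1_closed R N a t b.
  - by move: tab; rewrite in_itv/= => /andP[].
  - exact: iN.
  - by move: tab; rewrite in_itv/= => /andP[].
  - have := cN t (occ _ tab); rewrite within_interior//; exact: inner.
  by move=> dPt <-; rewrite derive1E; exact/derivableP.
have dIt t : t \in `]a, b[ -> is_derive t 1 I (D t).
  move=> tab.
  have cq : h^-1 *: (I (h *: 1 + t) - I t) @[h --> 0^'] --> D t.
    move=> B /(dI _ (occ _ tab)) IB.
    have nI : \forall s \near t, s != t -> B ((s - t)^-1 * (I s - I t)).
      have {}IB : \forall s \near t,
        s != t -> s \in `[a, b] -> B ((s - t)^-1 * (I s - I t)) by exact: IB.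
      by apply: filterS2 (inner _ tab) IB => s sab sB st; exact: sB.
    have /nbhs_ballP[e e0 eB] := nI.
    exists e => // h; rewrite /ball/= sub0r normrN => he h0.
    have := eB (h + t); rewrite /ball/= opprD addrCA subrr addr0 normrN => /(_ he).
    rewrite -subr_eq0 addrK => /(_ h0).
    by rewrite [h%:A]mulr1.
  by apply: DeriveDef; [apply: cvgP cq|exact: cvg_lim cq].
have wI : {within `[a, b], continuous I}.
  apply/subspace_continuousP => t tab.
  apply/cvgrPdist_lt => e e0.
  have c0 : (s - t) * ((s - t)^-1 * (I s - I t)) @[s --> within `[a, b] t^'] --> 0.
    rewrite -(mul0r (D t)); apply: cvgM; last exact: dI.
    rewrite /dnbhs; do 2!apply: cvg_within_filter.
    have : (id - cst t : R -> R) s @[s --> t] --> t - t.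
      by apply: cvgB; [exact: cvg_id|exact: cvg_cst].
    by rewrite subrr.
  have c1 : \forall s \near t, s != t -> s \in `[a, b] ->
      `|0 - (s - t) * ((s - t)^-1 * (I s - I t))| < e.
    by have /cvgrPdist_lt/(_ e e0) := c0.
  suff : \forall s \near t, s \in `[a, b] -> `|I t - I s| < e by [].
  apply: filterS c1 => s sP sab; have [->|st] := eqVneq s t.
    by rewrite subrr normr0.
  have := sP st sab; rewrite sub0r normrN mulrA mulfV ?subr_eq0// mul1r.
  by rewrite distrC.
have dIP t : t \in `]a, b[ -> is_derive t 1 (I - P) (D t - N t).
  by move=> tab; apply: is_deriveB; [exact: dIt|exact: dP].
have : (I - P) b <= (I - P) a.
  apply: (@ler0_derive1_le_cc R (I - P) a b); rewrite ?in_itv/= ?lexx ?ltW//.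
  - by move=> t /dIP h; exact: ex_derive.
  - move=> t tab; have h := dIP _ tab; rewrite derive1E derive_val subr_le0.
    exact/DN/occ.
  - by move=> x; exact: (continuousB (wI x) (wP x)).
have -> : (I - P) b = I b - P b by [].
have -> : (I - P) a = I a - P a by [].
have -> : P a = 0 by rewrite /P set_itv1 Rintegral_set1.
by rewrite /P; lra.
Unshelve. all: by end_near. Qed.

(** * Cauchy-Schwarz inequality and uniform limits of integrals *)

(** A quadratic polynomial without sign change has nonpositive discriminant. *)
Lemma discriminant_le {R : realFieldType} (P Q S : R) :
  0 <= Q -> (forall s, 0 <= P - 2 * s * S + s ^+ 2 * Q) -> S ^+ 2 <= P * Q.
Proof.
move=> Q0 pos.
have [Qeq0|Qn0] := eqVneq Q 0.
  rewrite Qeq0 in pos; rewrite Qeq0 mulr0.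
  have [->|Sn0] := eqVneq S 0; first by rewrite expr0n.
  have := pos ((P + 1) / (2 * S)).
  have -> : 2 * ((P + 1) / (2 * S)) * S = P + 1 by field.
  by rewrite mulr0; lra.
have := pos (S / Q).
have -> : P - 2 * (S / Q) * S + (S / Q) ^+ 2 * Q = (P * Q - S ^+ 2) / Q by field.
by rewrite pmulr_lge0 ?invr_gt0 ?subr_ge0// lt_neqAle eq_sym Qn0.
Qed.

Section continuity_on_a_set.
Context {R : realType} {T : topologicalType} (O : set T).
Implicit Types f h : T -> R.

Lemma continuous_in_cst (c : R) : {in O, continuous (fun=> c)}.
Proof. by move=> y _; exact: cvg_cst. Qed.

Lemma continuous_inD f h : {in O, continuous f} -> {in O, continuous h} ->
  {in O, continuous (fun y => f y + h y)}.
Proof.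
by move=> cf ch y Oy; apply: (@cvgD _ _ _ (nbhs y)); [exact: cf|exact: ch].
Qed.

Lemma continuous_inM f h : {in O, continuous f} -> {in O, continuous h} ->
  {in O, continuous (fun y => f y * h y)}.
Proof.
by move=> cf ch y Oy; apply: (@cvgM _ _ (nbhs y)); [exact: cf|exact: ch].
Qed.

Lemma continuous_inX f (k : nat) : {in O, continuous f} ->
  {in O, continuous (fun y => f y ^+ k)}.
Proof. by move=> cf y Oy; apply: (@cvgr_exp _ _ (nbhs y)); exact: cf. Qed.

End continuity_on_a_set.

Section uniform_limits.
Context {R : realType} {n : nat} (O Kc Om : set 'rV[R]_n).
Hypothesis dom : integration_domain O Kc Om.
Local Notation J := (@integral_rV R n Om).
Implicit Types (f h L : 'rV[R]_n -> R) (F : set_system R).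

Lemma integral_rV_cauchy_schwarz f h :
  {in O, continuous f} -> {in O, continuous h} ->
  J (fun y => f y * h y) ^+ 2 <= J (fun y => f y ^+ 2) * J (fun y => h y ^+ 2).
Proof.
move=> cf ch; apply: discriminant_le => [|s].
  by apply: integral_rV_ge0 => y _; exact: sqr_ge0.
have cff := continuous_inX (k := 2) cf; have chh := continuous_inX (k := 2) ch.
have cfh := continuous_inM cf ch.
have cZ (k : R) (u : 'rV[R]_n -> R) : {in O, continuous u} ->
    {in O, continuous (fun y => k * u y : R)}.
  by apply: continuous_inM; exact: continuous_in_cst.
have -> : J (fun y => f y ^+ 2) - 2 * s * J (fun y => f y * h y) +
    s ^+ 2 * J (fun y => h y ^+ 2) = J (fun y => (f y - s * h y) ^+ 2).
  rewrite -mulNr -!(integral_rVZ dom)// -!(integral_rVD dom)//; last 3 first.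
  - by apply: continuous_inD => //; exact: cZ.
  - exact: cZ.
  - exact: cZ.
  by apply: eq_integral_rV => y _; ring.
by apply: integral_rV_ge0 => y _; exact: sqr_ge0.
Qed.

Lemma norm_integral_rV_le f c : {in O, continuous f} ->
  (forall y, Om y -> `|f y| <= c) -> `|J f| <= c * J (fun=> 1).
Proof.
move=> cf fc; have c1 : {in O, continuous (fun _ : 'rV[R]_n => 1 : R)}.
  exact: continuous_in_cst.
have cc k : {in O, continuous (fun _ : 'rV[R]_n => k * 1 : R)}.
  exact: continuous_in_cst.
rewrite ler_norml; apply/andP; split.
  rewrite -mulNr -(integral_rVZ dom)//; apply: (le_integral_rV dom) => // y /fc.
  by rewrite ler_norml mulr1 => /andP[].
rewrite -(integral_rVZ dom)//; apply: (le_integral_rV dom) => // y /fc.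
by rewrite ler_norml mulr1 => /andP[].
Qed.

Definition unif_cvg F (phi : R -> 'rV[R]_n -> R) L : Prop :=
  forall e, 0 < e -> \forall s \near F, forall y, Kc y -> `|phi s y - L y| < e.

(** Compactness of Kc: convergence near each of its points, jointly in the
    parameter and the point, is uniform convergence. *)
Lemma unif_cvgP F (phi : R -> 'rV[R]_n -> R) L : Filter F -> {in O, continuous L} ->
  unif_cvg F phi L <->
  (forall y0, Kc y0 ->
    phi p.2 p.1 @[p --> filter_prod (within Kc (nbhs y0)) F] --> L y0).
Proof.
case: dom => oO cK KO OmK mOm FF cL.
have cL1 y0 : Kc y0 -> L p.1 @[p --> filter_prod (within Kc (nbhs y0)) F] --> L y0.
  move=> Ky0; apply: (@cvg_comp _ _ _ fst L _ (within Kc (nbhs y0))).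
    exact: cvg_fst.
  apply: cvg_within_filter; exact/cL/mem_set/KO.
split=> [uphi y0 Ky0|jphi e e0].
  have d0 : (phi p.2 p.1 - L p.1) @[p --> filter_prod (within Kc (nbhs y0)) F] --> 0.
    apply/cvgrPdist_lt => e e0; have ue := uphi e e0.
    exists (Kc, [set s | forall y, Kc y -> `|phi s y - L y| < e]).
      by split => //; exact: withinT.
    by move=> [y s] /= [Ky]; rewrite sub0r normrN; exact.
  have phiE : (fun p => phi p.2 p.1) =
      (fun p : 'rV[R]_n * R => phi p.2 p.1 - L p.1) + (fun p => L p.1).
    by apply/funext => p; rewrite fctE /= subrK.
  by rewrite phiE -[L y0]add0r; apply: cvgD => //; exact: cL1.
have /compact_near_coveringP/near_covering_withinP cov := cK.
apply: (cov R F (fun s y => `|phi s y - L y| < e)) => y0 Ky0.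
have d0 : (phi p.2 p.1 - L p.1) @[p --> filter_prod (within Kc (nbhs y0)) F] --> 0.
  have : (phi p.2 p.1 - L p.1) @[p --> filter_prod (within Kc (nbhs y0)) F] -->
      L y0 - L y0 by apply: cvgB; [exact: jphi|exact: cL1].
  by rewrite subrr.
have /cvgrPdist_lt/(_ e e0)[[B C] [/= By CF] BC] := d0.
exists ([set y | Kc y -> B y], C) => // -[y s] /= [KB Cs] Ky.
have := BC (y, s); rewrite /= sub0r normrN; apply.
by split => //; exact: KB.
Qed.

Lemma cvg_integral_rV F (phi : R -> 'rV[R]_n -> R) L : Filter F ->
  {in O, continuous L} -> (\forall s \near F, {in O, continuous (phi s)}) ->
  unif_cvg F phi L -> J (phi s) @[s --> F] --> J L.
Proof.
case: (dom) => oO cK KO OmK mOm FF cL cphi uphi.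
apply/cvgrPdist_lt => e e0.
have V0 : 0 <= J (fun=> 1) by exact: integral_rV_ge0.
have d0 : 0 < e / (J (fun=> 1) + 1) by rewrite divr_gt0// ltr_wpDl.
near=> s.
have cs : {in O, continuous (phi s)} by near: s.
have us : forall y, Kc y -> `|phi s y - L y| < e / (J (fun=> 1) + 1).
  by near: s; exact: uphi.
have -> : J L - J (phi s) = J (fun y => L y + -1 * phi s y).
  rewrite (integral_rVD dom)// ?(integral_rVZ dom)// ?mulN1r//.
  by apply: continuous_inM => //; exact: continuous_in_cst.
have := @norm_integral_rV_le (fun y => L y + -1 * phi s y) (e / (J (fun=> 1) + 1)).
have cd : {in O, continuous (fun y => L y + -1 * phi s y)}.
  apply: continuous_inD => //; apply: continuous_inM => //.
  exact: continuous_in_cst.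
have sub y : Om y -> `|L y + -1 * phi s y| <= e / (J (fun=> 1) + 1).
  by move=> /OmK Ky; rewrite mulN1r distrC ltW// us.
move=> /(_ cd sub) /le_lt_trans; apply.
by rewrite mulrAC ltr_pdivrMr ?ltr_wpDl// ltr_pM2l// ltrDl.
Unshelve. all: by end_near. Qed.

End uniform_limits.

Arguments unif_cvgP {R n O Kc Om} dom {F phi L FF}.

(** * Observables along a path in one chart *)

Section observable_limits.
Context {R : realType} {n : nat} {T : Type} (F : set_system T) {FF : Filter F}.
Variables (A h : T -> 'M[R]_n) (L Lh : 'M[R]_n).
Hypotheses (pL : posdef L) (cA : mx_cvg F A L) (ch : mx_cvg F h Lh).

Lemma cvg_damping : damping (A t) @[t --> F] --> damping L.
Proof.
apply: cvgr_exp; apply: cvgV; last exact: cvg_distortion (posdef_unit pL) cA.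
by apply: lt0r_neq0; exact: distortion_gt0.
Qed.

Lemma cvg_observable o : observable o (A t) @[t --> F] --> observable o L.
Proof.
apply: cvgM; first exact: cvg_damping.
by case: o => [[i j]|]; [exact: cA|exact: cvg_cst].
Qed.

Lemma cvg_d_observable o :
  d_observable o (A t) (h t) @[t --> F] --> d_observable o L Lh.
Proof.
have uL := posdef_unit pL.
apply: cvgD; apply: cvgM.
- apply: cvgN; apply: cvgM; last first.
    apply: cvgB; first exact: cvg_mxtrace.
    apply: cvg_mxtrace; apply: mx_cvg_mul; last exact: mx_cvg_inv.
    by apply: mx_cvg_mul => //; exact: mx_cvg_inv.
  apply: cvgM; first exact: cvg_cst.
  apply: cvgr_exp; apply: cvgV; last exact: cvg_distortion.
  by apply: lt0r_neq0; exact: distortion_gt0.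
- by case: o => [[i j]|]; [exact: cA|exact: cvg_cst].
- exact: cvg_damping.
- by case: o => [[i j]|]; [exact: ch|exact: cvg_cst].
Qed.

End observable_limits.

Section coordinate_path.
Context {R : realType} {n : nat} (O Kc Om : set 'rV[R]_n).
Hypothesis dom : integration_domain O Kc Om.
Local Notation J := (@integral_rV R n Om).

(** A C^1 path of metrics as seen in one chart: A t y is the matrix of the
    metric at time t and at the point of coordinates y, A' t y that of its
    velocity. *)
Definition coordinate_path (A A' : R -> 'rV[R]_n -> 'M[R]_n) (a b : R) : Prop :=
  forall t, t \in `[a, b] ->
  [/\ forall y, O y -> posdef (A t y) /\ (A' t y)^T = A' t y,
      forall i j, {in O, continuous (fun y => A t y i j)},
      forall i j, {in O, continuous (fun y => A' t y i j)},
      forall i j, unif_cvg Kc (within `[a, b] t^')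
        (fun s y => (s - t)^-1 * (A s y i j - A t y i j)) (fun y => A' t y i j) &
      forall i j, unif_cvg Kc (within `[a, b] (nbhs t))
        (fun s y => A' s y i j) (fun y => A' t y i j)].

Variables (A A' : R -> 'rV[R]_n -> 'M[R]_n) (a b : R).
Hypothesis pathA : coordinate_path A A' a b.

Local Notation at_ t y0 G := (filter_prod (within Kc (nbhs y0)) (G : set_system R)).

(** Uniform convergence of the difference quotients gives, at each point, the
    limits that the calculus of difference quotients takes as input; the values
    at s themselves converge since A s = A t + (s - t) q with q convergent. *)
Let path_quot_cvg t y0 : t \in `[a, b] -> Kc y0 ->
  mx_quot_cvg (at_ t y0 (within `[a, b] t^')) (fun p => (p.2 - t)^-1)
    (fun p => A t p.1) (fun p => A p.2 p.1) (A t y0) (A' t y0).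
Proof.
move=> tab Ky0 i j; have [pA cA cA' qA _] := pathA tab.
have Oy0 : y0 \in O by case: (dom) => _ _ KO _ _; exact/mem_set/KO.
have c0 : A t p.1 i j @[p --> at_ t y0 (within `[a, b] t^')] --> A t y0 i j.
  apply: (@cvg_comp _ _ _ fst (fun y => A t y i j) _ (within Kc (nbhs y0))).
    exact: cvg_fst.
  by apply: cvg_within_filter; exact: cA.
have cq : (p.2 - t)^-1 * (A p.2 p.1 i j - A t p.1 i j)
    @[p --> at_ t y0 (within `[a, b] t^')] --> A' t y0 i j.
  by have /(unif_cvgP dom (cA' i j))/(_ y0 Ky0) := qA i j.
split => //.
have ct : p.2 - t @[p --> at_ t y0 (within `[a, b] t^')] --> (0 : R).
  apply: (@cvg_comp _ _ _ snd (fun s => s - t) _ (within `[a, b] t^')).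
    exact: cvg_snd.
  rewrite /dnbhs; do 2!apply: cvg_within_filter.
  have : (id - cst t : R -> R) s @[s --> t] --> t - t.
    by apply: cvgB; [exact: cvg_id|exact: cvg_cst].
  by rewrite subrr.
have nearA : \forall p \near at_ t y0 (within `[a, b] t^'),
    A t p.1 i j + (p.2 - t) * ((p.2 - t)^-1 * (A p.2 p.1 i j - A t p.1 i j)) =
    A p.2 p.1 i j.
  exists (setT, [set s | s != t]).
    split => //=; first exact: filterT.
    have : \forall s \near t^', s != t by exact: nbhs_dnbhs_neq.
    by rewrite /within/=; apply: filterS => s st _.
  move=> [y s] /= [_ st]; rewrite mulrA mulfV ?subr_eq0// mul1r.
  by rewrite addrC subrK.
apply: cvg_trans (near_eq_cvg nearA) _.
rewrite -[A t y0 i j](_ : A t y0 i j + 0 * A' t y0 i j = _).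
  by apply: cvgD => //; exact: cvgM.
by rewrite mul0r addr0.
Qed.

Let path_cvg t y0 : t \in `[a, b] -> Kc y0 ->
  mx_cvg (at_ t y0 (within `[a, b] (nbhs t))) (fun p => A p.2 p.1) (A t y0).
Proof.
move=> tab Ky0 i j; have [pA cA cA' qA _] := pathA tab.
suff /(unif_cvgP dom (cA i j))/(_ y0 Ky0) : unif_cvg Kc (within `[a, b] (nbhs t))
  (fun s y => A s y i j) (fun y => A t y i j) by [].
have : unif_cvg Kc (within `[a, b] t^') (fun s y => A s y i j) (fun y => A t y i j).
  apply/(unif_cvgP dom (cA i j)) => y1 Ky1.
  by case: (path_quot_cvg tab Ky1 i j).
move=> uA e e0; have {}uA : \forall s \near t, s != t -> s \in `[a, b] ->
    forall y, Kc y -> `|A s y i j - A t y i j| < e by exact: (uA e e0).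
suff : \forall s \near t, s \in `[a, b] ->
    forall y, Kc y -> `|A s y i j - A t y i j| < e by [].
apply: filterS uA => s sA sab y Ky; have [->|st] := eqVneq s t; last exact: sA.
by rewrite subrr normr0.
Qed.

Let velocity_cvg t y0 : t \in `[a, b] -> Kc y0 ->
  mx_cvg (at_ t y0 (within `[a, b] (nbhs t))) (fun p => A' p.2 p.1) (A' t y0).
Proof.
move=> tab Ky0 i j; have [pA cA cA' _ qA'] := pathA tab.
by have /(unif_cvgP dom (cA' i j))/(_ y0 Ky0) := qA' i j.
Qed.

Lemma cvg_energy_density (T : Type) (F : set_system T) (B h : T -> 'M[R]_n) LB Lh :
  Filter F -> posdef LB -> mx_cvg F B LB -> mx_cvg F h Lh ->
  energy_density (B t) (h t) @[t --> F] --> energy_density LB Lh.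
Proof.
move=> FF pB cB ch; apply: cvgM; first exact: cvg_metric_sqnorm (posdef_unit pB) _ _.
by apply: cvg_sqrt; exact: cvg_det.
Qed.

Lemma continuous_energy_density (B h : 'rV[R]_n -> 'M[R]_n) :
  (forall y, O y -> posdef (B y)) ->
  (forall i j, {in O, continuous (fun y => B y i j)}) ->
  (forall i j, {in O, continuous (fun y => h y i j)}) ->
  {in O, continuous (fun y => energy_density (B y) (h y))}.
Proof.
move=> pB cB ch y Oy; apply: (@cvg_energy_density _ (nbhs y)).
- exact/pB/set_mem.
- by move=> i j; exact: cB.
- by move=> i j; exact: ch.
Qed.

Lemma continuous_observable o (B : 'rV[R]_n -> 'M[R]_n) :
  (forall y, O y -> posdef (B y)) ->
  (forall i j, {in O, continuous (fun y => B y i j)}) ->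
  {in O, continuous (fun y => observable o (B y))}.
Proof.
move=> pB cB y Oy; apply: (@cvg_observable _ _ _ (nbhs y)).
- exact/pB/set_mem.
- by move=> i j; exact: cB.
Qed.

Lemma continuous_d_observable o (B h : 'rV[R]_n -> 'M[R]_n) :
  (forall y, O y -> posdef (B y)) ->
  (forall i j, {in O, continuous (fun y => B y i j)}) ->
  (forall i j, {in O, continuous (fun y => h y i j)}) ->
  {in O, continuous (fun y => d_observable o (B y) (h y))}.
Proof.
move=> pB cB ch y Oy; apply: (@cvg_d_observable _ _ _ (nbhs y)).
- exact/pB/set_mem.
- by move=> i j; exact: cB.
- by move=> i j; exact: ch.
Qed.

Lemma cvg_energy t : t \in `[a, b] ->
  J (fun y => energy_density (A s y) (A' s y)) @[s --> within `[a, b] (nbhs t)] -->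
  J (fun y => energy_density (A t y) (A' t y)).
Proof.
move=> tab; have cE s : s \in `[a, b] ->
    {in O, continuous (fun y => energy_density (A s y) (A' s y))}.
  move=> /pathA[pA cA cA' _ _]; apply: continuous_energy_density => //.
  by move=> y /pA[].
apply: (cvg_integral_rV dom); first exact: cE.
  by apply: filterS (withinT `[a, b]%classic _) => s; exact: cE.
apply/(unif_cvgP dom); first exact: cE.
move=> y0 Ky0; have [pA _ _ _ _] := pathA tab.
apply: cvg_energy_density; [|exact: path_cvg|exact: velocity_cvg].
by case: (dom) => _ _ KO _ _; have [] := pA _ (KO _ Ky0).
Qed.

(** Differentiation under the integral sign, by uniform convergence. *)
Lemma cvg_observable_quotient o (psi : 'rV[R]_n -> R) t : {in O, continuous psi} ->
  t \in `[a, b] ->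
  (s - t)^-1 * (J (fun y => observable o (A s y) * psi y) -
    J (fun y => observable o (A t y) * psi y)) @[s --> within `[a, b] t^'] -->
  J (fun y => d_observable o (A t y) (A' t y) * psi y).
Proof.
move=> cpsi tab.
have cO s : s \in `[a, b] -> {in O, continuous (fun y => observable o (A s y))}.
  by move=> /pathA[pA cA _ _ _]; apply: continuous_observable => // y /pA[].
have cdO : {in O, continuous (fun y => d_observable o (A t y) (A' t y) * psi y)}.
  apply: continuous_inM => //; have [pA cA cA' _ _] := pathA tab.
  by apply: continuous_d_observable => // y /pA[].
pose q s y := (s - t)^-1 * (observable o (A s y) - observable o (A t y)) * psi y.
have cq s : s \in `[a, b] -> {in O, continuous (q s)}.
  move=> sab; apply: continuous_inM => //; apply: continuous_inM.
    exact: continuous_in_cst.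
  by move=> y Oy; apply: (@cvgB _ _ _ (nbhs y)); [exact: cO|exact: cO].
have : J (q s) @[s --> within `[a, b] t^'] -->
    J (fun y => d_observable o (A t y) (A' t y) * psi y).
  apply: (cvg_integral_rV dom) => //.
    by apply: filterS (withinT `[a, b]%classic _) => s; exact: cq.
  apply/(unif_cvgP dom) => // y0 Ky0; case: (dom) => _ _ KO _ _.
  apply: cvgM.
    have [pA _ _ _ _] := pathA tab; have [pAy _] := pA _ (KO _ Ky0).
    by have [_ _ +] := quot_cvg_observable o pAy (path_quot_cvg tab Ky0).
  apply: (@cvg_comp _ _ _ fst psi _ (within Kc (nbhs y0))); first exact: cvg_fst.
  by apply: cvg_within_filter; exact/cpsi/mem_set/KO.
apply: cvg_trans; apply: near_eq_cvg.
apply: filterS (withinT `[a, b]%classic _) => s sab.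
rewrite -[- J _]mulN1r -(integral_rVZ dom); last by apply: continuous_inM => //; exact: cO.
rewrite -(integral_rVD dom).
- rewrite -(integral_rVZ dom).
    by apply: eq_integral_rV => y _; rewrite /q; ring.
  apply: continuous_inD; first by apply: continuous_inM => //; exact: cO.
  apply: continuous_inM; first exact: continuous_in_cst.
  by apply: continuous_inM => //; exact: cO.
- by apply: continuous_inM => //; exact: cO.
- apply: continuous_inM; first exact: continuous_in_cst.
  by apply: continuous_inM => //; exact: cO.
Qed.

(** Paired with a fixed function psi of the coordinates, an observable becomes a
    real function of time, whose speed is controlled by the energy of the path
    through Cauchy-Schwarz and [sqr_d_observable_le]. *)
Lemma observable_increment_le o (psi : 'rV[R]_n -> R) (N : R -> R) : a < b ->
  {in O, continuous psi} ->
  (forall t, t \in `[a, b] -> N s @[s --> within `[a, b] (nbhs t)] --> N t) ->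
  (forall t, t \in `[a, b] -> 0 <= N t /\
    J (fun y => energy_density (A t y) (A' t y)) <= N t ^+ 2) ->
  J (fun y => observable o (A b y) * psi y) - J (fun y => observable o (A a y) * psi y)
    <= Num.sqrt (lipschitz_const n * J (fun y => psi y ^+ 2)) *
       \int[lebesgue_measure]_(t in `[a, b]) N t.
Proof.
move=> ab cpsi cN EN; set k := Num.sqrt _.
have iN : lebesgue_measure.-integrable `[a, b] (EFin \o N).
  apply: continuous_compact_integrable; first exact: segment_compact.
  by apply/subspace_continuousP => t tab; exact: cN.
rewrite -RintegralZl//.
apply: (increment_le_integral (I := fun t => J (fun y => observable o (A t y) * psi y))
  (D := fun t => J (fun y => d_observable o (A t y) (A' t y) * psi y))) => //.
- by move=> t tab; apply: cvgM; [exact: cvg_cst|exact: cN].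
- by move=> t tab; exact: cvg_observable_quotient.
move=> t tab; have [N0 EtN] := EN t tab; have [pA cA cA' _ _] := pathA tab.
have cdO : {in O, continuous (fun y => d_observable o (A t y) (A' t y))}.
  by apply: continuous_d_observable => // y /pA[].
have cE : {in O, continuous (fun y => energy_density (A t y) (A' t y))}.
  by apply: continuous_energy_density => // y /pA[].
have p0 : 0 <= J (fun y => psi y ^+ 2).
  by apply: integral_rV_ge0 => y _; exact: sqr_ge0.
have C0 : 0 <= lipschitz_const n :> R by rewrite mulr_ge0// sqr_ge0.
apply: (le_trans (ler_norm _)); rewrite -(@ger0_norm _ (k * N t)); last first.
  by rewrite mulr_ge0// sqrtr_ge0.
rewrite -ler_sqr ?nnegrE// !real_normK ?num_real//.
apply: (le_trans (integral_rV_cauchy_schwarz dom cdO cpsi)).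
rewrite exprMn sqr_sqrtr; last by rewrite mulr_ge0.
rewrite mulrAC ler_wpM2r//.
apply: (@le_trans _ _ (lipschitz_const n * J (fun y => energy_density (A t y) (A' t y)))).
  rewrite -(integral_rVZ dom)//; apply: (le_integral_rV dom).
  - exact: continuous_inX.
  - by apply: continuous_inM => //; exact: continuous_in_cst.
  case: (dom) => _ _ KO OmK _ y /OmK/KO/pA[py sy].
  exact: sqr_d_observable_le.
by rewrite ler_wpM2l.
Qed.

End coordinate_path.

(** * Smooth functions and Jacobians *)

Section smooth_combinations.
Context {R : realType}.

(** The differential is 0, the remainder being 0 near x. *)
Lemma differentiable_near0 (V W : normedModType R) (f : V -> W) x :
  (\forall y \near x, f y = 0) -> differentiable f x.
Proof.
move=> f0; have fx0 : f x = 0 by exact: nbhs_singleton f0.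
have fo : f \o shift x = cst (f x) + (\0 : V -> W) +o_ 0 id.
  apply/eqaddoP => e e0; rewrite fx0.
  have : \forall h \near (0 : V), f (h + x) = 0.
    have : (h + x) @[h --> (0 : V)] --> 0 + x.
      by apply: cvgD; [exact: cvg_id|exact: cvg_cst].
    by rewrite add0r => /(_ _ f0).
  apply: filterS => h fh /=; rewrite !fctE /= fh addr0 subrr normr0.
  by rewrite mulr_ge0// ltW.
have c0 : continuous (\0 : {linear V -> W}) by move=> y; exact: cvg_cst.
have d0 := diff_unique c0 fo.
by apply/diff_locallyP; rewrite d0.
Qed.

Lemma near_eq_differentiable (V W : normedModType R) (f g : V -> W) x :
  (\forall y \near x, f y = g y) -> differentiable f x -> differentiable g x.
Proof.
move=> fg df; have -> : g = f + (g - f) by rewrite addrC subrK.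
apply: differentiableD => //; apply: differentiable_near0.
apply: filterS fg => y fgy.
by have -> : (g - f) y = g y - f y by []; rewrite fgy subrr.
Qed.

(** A directional derivative depends only on the values near the point, hence the
    induction needs D open. *)
Lemma pderivs_linear n (D : set 'rV[R]_n) f h (k : R) s y : open D ->
  smooth_on D f -> smooth_on D h -> D y ->
  pderivs s (fun z => f z + k * h z) y = pderivs s f y + k * pderivs s h y.
Proof.
move=> oD sf sh; elim: s y => [//|i s IH] y Dy /=.
have nearE : \forall z \near y, pderivs s (fun z => f z + k * h z) z =
    (pderivs s f + k *: pderivs s h) z.
  have : nbhs y D by exact: open_nbhs_nbhs.
  by apply: filterS => z Dz; exact: IH.
rewrite (near_eq_derive _ nearE) deriveD ?deriveZ//.
- exact/diff_derivable/sh.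
- exact/diff_derivable/sf.
- exact/derivableZ/diff_derivable/sh.
Qed.

Lemma smooth_on_linear n (D : set 'rV[R]_n) f h (k : R) : open D ->
  smooth_on D f -> smooth_on D h -> smooth_on D (fun z => f z + k * h z).
Proof.
move=> oD sf sh s y Dy.
apply: (@near_eq_differentiable _ _ (pderivs s f + k *: pderivs s h)).
  have : nbhs y D by exact: open_nbhs_nbhs.
  by apply: filterS => z Dz; rewrite (pderivs_linear k s oD sf sh Dz).
by apply: differentiableD; [exact: sf|apply: differentiableZ; exact: sh].
Qed.

Lemma pderivs0 n (s : seq 'I_n) : pderivs s (fun=> 0 : R) = fun=> 0.
Proof.
elim: s => [//|i s IH] /=; rewrite IH.
by apply/funext => y; rewrite derive_cst.
Qed.

Lemma differentiable_rV m n (F : 'rV[R]_m -> 'rV[R]_n) y :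
  (forall j, differentiable (fun z => F z 0 j) y) -> differentiable F y.
Proof.
move=> dF; have -> : F = \sum_j (fun z => F z 0 j *: delta_mx 0 j).
  by apply/funext => z; rewrite fct_sumE /= [LHS]row_sum_delta.
by apply: differentiable_sum => j; exact: differentiableZl.
Qed.

(** Chain rule; Jacobian matrices act on row vectors from the right, which fixes
    the order of the product. *)
Lemma mul_jacobian n (F G : 'rV[R]_n -> 'rV[R]_n) y :
  differentiable F y -> differentiable G (F y) ->
  (\forall z \near y, G (F z) = z) -> 'J F y *m 'J G (F y) = 1%:M.
Proof.
move=> dF dG GF; apply/row_matrixP => i; rewrite !rowE mulmx1 mulmxA.
set v := delta_mx 0 i.
rewrite /jacobian mul_rV_lin1 mul_rV_lin1.
have DGF : 'D_v (G \o F) y = v by rewrite (near_eq_derive _ GF) derive_id.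
rewrite -[RHS]DGF deriveE; last exact: differentiable_comp.
exact: esym (congr1 (fun u : 'rV_n -> 'rV_n => u v) (diff_comp dF dG)).
Qed.

End smooth_combinations.

(** * Tensors in charts *)

(* The composition of functions in scope hides the components of a tensor. *)
Local Notation comp := Defs.comp.

Section charts.
Context {R : realType} {n : nat} {M : topologicalType}.
Variable S : smooth_structure R n M.
Implicit Types (c : chart R n M) (g h k : tensor R n M).

(** The image of V is the part of the range of c that the continuous inverse of c
    sends into V. *)
Lemma open_chart_image c (V : set M) : open V -> V `<=` cdom c ->
  open (cmap c @` V).
Proof.
move=> oV Vc; have oran : open (cran c) := @cran_open _ _ _ c.
rewrite openE => _ [x Vx <-].
have ranx : cran c (cmap c x) by exists x => //; exact: Vc.
have : {in cran c, continuous (cinv c)}.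
  by rewrite -(continuous_open_subspace _ oran); exact: cinv_continuous.
move=> /(_ _ (mem_set ranx)); rewrite /continuous_at (cmapK (Vc _ Vx)) => cx.
have nV : nbhs (cmap c x) (cinv c @^-1` V) by apply: cx; exact: open_nbhs_nbhs.
have nr : nbhs (cmap c x) (cran c) by exact: open_nbhs_nbhs.
rewrite /interior; apply: filterS2 nV nr => z /= Vz [w cw wz].
by exists (cinv c z) => //; rewrite -wz cmapK.
Qed.

Lemma compact_chart_image c (K : set M) : compact K -> K `<=` cdom c ->
  compact (cmap c @` K).
Proof.
move=> cK Kc; apply: continuous_compact cK.
exact: continuous_subspaceW Kc (@cmap_continuous _ _ _ c).
Qed.

(** The transition map back is an inverse near the point. *)
Lemma jacobian_transition_unit c c' x : atlas S c -> atlas S c' ->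
  cdom c x -> cdom c' x -> 'J (transition c c') (cmap c x) \in unitmx.
Proof.
move=> ac ac' cx c'x.
have [sm sm'] := atlas_compat ac ac'.
have ov : overlap c c' (cmap c x) by exists x.
have ov' : overlap c' c (cmap c' x) by exists x.
have trx : transition c c' (cmap c x) = cmap c' x by rewrite /transition/= cmapK.
have dF : differentiable (transition c c') (cmap c x).
  by apply: differentiable_rV => j; exact: (sm j [::] _ ov).
have dG : differentiable (transition c' c) (transition c c' (cmap c x)).
  by rewrite trx; apply: differentiable_rV => j; exact: (sm' j [::] _ ov').
suff GF : \forall z \near cmap c x, transition c' c (transition c c' z) = z.
  have JJ := mul_jacobian dF dG GF.
  case: (mulmx1_unit JJ) => uJ _.
  exact: uJ.
have oo : open (overlap c c').
  apply: open_chart_image; last by move=> y [].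
  by apply: openI; exact: cdom_open.
have : nbhs (cmap c x) (overlap c c') by exact: open_nbhs_nbhs.
apply: filterS => z [y [cy c'y] <-].
by rewrite /transition/= cmapK// cmapK.
Qed.

Section one_chart.
Variables (c : chart R n M) (x : M).
Hypotheses (ac : atlas S c) (cx : cdom c x).

Let uJ : 'J (transition c (chart_at S x)) (cmap c x) \in unitmx.
Proof.
apply: jacobian_transition_unit => //; first exact: chart_at_atlas.
exact: chart_at_dom.
Qed.

Lemma comp_posdef g : posdef (g x) -> posdef (comp S c g x).
Proof. exact: posdef_congr. Qed.

Lemma comp_sym h : (h x)^T = h x -> (comp S c h x)^T = comp S c h x.
Proof. by move=> sh; rewrite /comp !trmx_mul trmxK sh mulmxA. Qed.

Lemma comp_qform (v : 'rV[R]_n) : exists w : 'rV[R]_n,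
  forall h, v *m comp S c h x *m v^T = w *m h x *m w^T.
Proof.
exists (v *m 'J (transition c (chart_at S x)) (cmap c x)).
by move=> h; rewrite /comp trmx_mul !mulmxA.
Qed.

(** The trace of an endomorphism does not depend on the frame. *)
Lemma metric_sqnorm_comp g h : posdef (g x) ->
  metric_sqnorm (comp S c g x) (comp S c h x) = metric_sqnorm (g x) (h x).
Proof.
move=> pg; have ug := posdef_unit pg; rewrite /comp.
have := uJ; set J := jacobian _ _ => uJx.
have uJT : J^T \in unitmx by rewrite unitmx_tr.
have ic : invmx (J *m g x *m J^T) = invmx J^T *m invmx (g x) *m invmx J.
  have uc : J *m g x *m J^T \in unitmx by rewrite !unitmx_mul uJx ug uJT.
  apply: (can_inj (mulKmx uc)); rewrite mulmxV// !mulmxA mulmxK//.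
  by rewrite mulmxK// mulmxV.
have invJ (X : 'M[R]_n) : invmx (J *m g x *m J^T) *m (J *m X *m J^T) =
    invmx J^T *m (invmx (g x) *m X) *m J^T.
  by rewrite ic !mulmxA mulmxKV.
rewrite /metric_sqnorm -[_ *m invmx _ *m _]mulmxA !invJ.
by rewrite !mulmxA mulmxK// mxtrace_mulC !mulmxA mulmxV// mul1mx.
Qed.

End one_chart.

Lemma comp_linear c g h (k : R) x :
  comp S c (g + k *: h) x = comp S c g x + k *: comp S c h x.
Proof.
rewrite /comp; have -> : (g + k *: h) x = g x + k *: h x by [].
by rewrite mulmxDr mulmxDl -scalemxAr -scalemxAl.
Qed.

Lemma continuous_chart_comp c h i j : atlas S c -> smooth_tensor S h ->
  {in cran c, continuous (fun y => comp S c h (cinv c y) i j)}.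
Proof.
move=> ac sh y /set_mem cy; apply: differentiable_continuous.
exact: (sh c i j ac [::] y cy).
Qed.

Lemma smooth_tensor_linear g h (k : R) : smooth_tensor S g -> smooth_tensor S h ->
  smooth_tensor S (g + k *: h).
Proof.
move=> sg sh c i j ac.
have -> : (fun y => comp S c (g + k *: h) (cinv c y) i j) =
    (fun y => comp S c g (cinv c y) i j + k * comp S c h (cinv c y) i j).
  by apply/funext => y; rewrite comp_linear !mxE.
by apply: smooth_on_linear; [exact: cran_open|exact: sg|exact: sh].
Qed.

Lemma sym_tensors_linear g h (k : R) : sym_tensors S g -> sym_tensors S h ->
  sym_tensors S (g + k *: h).
Proof.
move=> [sg tg] [sh th]; split; first exact: smooth_tensor_linear.
move=> x; have -> : (g + k *: h) x = g x + k *: h x by [].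
by rewrite linearD linearZ/= tg th.
Qed.

Lemma metrics_posdef g x : metrics S g -> posdef (g x).
Proof. by move=> [[_ sg] pg]; split; [exact: sg|exact: pg]. Qed.

Variable A : amenable_atlas S.

(** Charts are injective, so that the image of a piece is a difference of images
    of open sets. *)
Lemma piece_domain (a : 'I_(asize A)) :
  integration_domain (cran (aV a)) (cmap (aV a) @` aK a)
  (cmap (aV a) @` piece a).
Proof.
have UK := @aUK _ _ _ _ A a; have KV := @aKV _ _ _ _ A a.
split.
- exact: cran_open.
- by apply: compact_chart_image => //; exact: aK_compact.
- exact: image_subset.
- by apply: image_subset => x [/UK].
pose W := \bigcup_(b in [set b : 'I_(asize A) | (b < a)%N]) aU b.
have oW : open W by apply: bigcup_open => b _; exact: aU_open.
have -> : cmap (aV a) @` piece a =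
    cmap (aV a) @` aU a `\` cmap (aV a) @` (aU a `&` W).
  apply/seteqP; split => [_ [x [Ux nWx] <-]|_ [[x Ux <-] nW]].
    split; first by exists x.
    move=> [z [Uz Wz] xz]; apply: nWx.
    by rewrite -(cmapK (KV _ (UK _ Ux))) -xz (cmapK (KV _ (UK _ Uz))).
  by exists x => //; split => // Wx; apply: nW; exists x.
apply: (@measurableD _ _ (@rV_of_tuple R n @^-1` (cmap (aV a) @` aU a))
  (@rV_of_tuple R n @^-1` (cmap (aV a) @` (aU a `&` W))));
  apply: measurable_preimage_rV_open.
  apply: open_chart_image; first exact: aU_open.
  by move=> x /UK/KV.
apply: open_chart_image; last by move=> x [/UK/KV].
by apply: openI => //; exact: aU_open.
Qed.

End charts.

(** * Quadratic forms and least eigenvalues *)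

Section quadratic_forms.
Context {R : realType} {n : nat}.
Implicit Types (A G Q : 'M[R]_n) (v w : 'rV[R]_n).

Definition qform A v : R := (v *m A *m v^T) 0 0.

Lemma qform_combine Q v w (s : R) : Q^T = Q ->
  qform Q (v - s *: w) =
    qform Q v - 2 * s * (v *m Q *m w^T) 0 0 + s ^+ 2 * qform Q w.
Proof.
move=> sQ; have swap : (w *m Q *m v^T) 0 0 = (v *m Q *m w^T) 0 0.
  by rewrite -[in LHS](trmxK (w *m Q *m v^T)) mxE !trmx_mul trmxK sQ mulmxA.
rewrite /qform [(v - s *: w)^T]linearB/= [(s *: w)^T]linearZ/= !(mulmxBl, mulmxBr).
rewrite -!scalemxAr -!scalemxAl !mxE.
have -> : \sum_j (w *m Q) 0 j * v^T j 0 = (w *m Q *m v^T) 0 0 by rewrite mxE.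
rewrite swap mxE; ring.
Qed.

Lemma qform_cauchy_schwarz Q v w : Q^T = Q -> (forall u, 0 <= qform Q u) ->
  (v *m Q *m w^T) 0 0 ^+ 2 <= qform Q v * qform Q w.
Proof.
move=> sQ Q0; apply: discriminant_le => // s.
by rewrite -qform_combine.
Qed.

(** Cauchy-Schwarz between v and the basis vectors. *)
Lemma semidefinite_kernel Q v : Q^T = Q -> (forall u, 0 <= qform Q u) ->
  qform Q v = 0 -> v *m Q = 0.
Proof.
move=> sQ Q0 v0; apply/rowP => j; rewrite [RHS]mxE.
have := qform_cauchy_schwarz v (delta_mx 0 j) sQ Q0.
rewrite v0 mul0r trmx_delta -colE !mxE => h.
by apply/eqP; rewrite -sqrf_eq0 eq_le h sqr_ge0.
Qed.

Lemma qformZ Q v (s : R) : qform Q (s *: v) = s ^+ 2 * qform Q v.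
Proof. by rewrite /qform linearZ/= -!scalemxAl -scalemxAr !mxE; ring. Qed.

Lemma posdef_qform_ge0 G v : posdef G -> 0 <= qform G v.
Proof.
move=> [_ pG]; have [->|v0] := eqVneq v 0; last exact/ltW/pG.
by rewrite /qform !mul0mx mxE.
Qed.

Lemma continuous_qform Q : continuous (qform Q).
Proof.
move=> v; have cid : mx_cvg (nbhs v) id v by move=> i j; exact: coord_continuous.
have := @mx_cvg_mul _ _ (nbhs v) _ _ _ _ (fun u => u *m Q) (fun u => u^T) (v *m Q) v^T.
apply.
- apply: (@mx_cvg_mul _ _ (nbhs v)) => //.
  by move=> i j; exact: cvg_cst.
- by move=> i j; rewrite mxE; under eq_fun do rewrite mxE; exact: cid.
Qed.

(** The least generalised eigenvalue l of A with respect to G is the minimum of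
    the Rayleigh quotient, attained by compactness of the unit sphere; at the
    minimum v the semidefinite form A - l G vanishes, so v is in its kernel. *)
Lemma rayleigh_minimum A G : (0 < n)%N -> A^T = A -> posdef G ->
  exists l v, [/\ v != 0, v *m A = l *: (v *m G) &
    forall w, l * qform G w <= qform A w].
Proof.
move=> n0 sA pG.
have G0 v : v != 0 -> 0 < qform G v by move=> ?; exact: pG.2.
pose K : set 'rV[R]_n := [set v | `|v| = 1].
have K0 v : K v -> v != 0.
  by move=> Kv; apply/eqP => v0; move: Kv; rewrite /K/= v0 normr0 => /esym/eqP;
    rewrite oner_eq0.
pose q v := qform A v / qform G v.
have cK : compact K.
  apply: bounded_closed_compact.
    exists 1; split; first exact: num_real.
    by move=> x x1 v /= ->; exact: ltW.
  have -> : K = (fun v : 'rV[R]_n => `|v|) @^-1` [set 1 : R] by [].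
  apply: preimage_closed; last exact: closed_eq.
  by move=> v _; exact: norm_continuous.
have nK w : w != 0 -> K (`|w|^-1 *: w).
  move=> w0; rewrite /K/= normrZ normfV normr_id mulVf// normr_eq0//.
have [||v Kv vmin] := @compact_EVT_min _ R q K _ cK.
- pose w : 'rV[R]_n := const_mx 1; exists (`|w|^-1 *: w); apply: nK.
  apply/eqP => /rowP/(_ (Ordinal n0)); rewrite !mxE => /eqP.
  by rewrite oner_eq0.
- apply: continuous_in_subspaceT => v /set_mem Kv.
  apply: (@cvgM _ _ (nbhs v)); first exact: continuous_qform.
  apply: (@cvgV _ _ (nbhs v)); last exact: continuous_qform.
  by rewrite gt_eqF// G0// K0.
have {}Kv := set_mem Kv.
have lmin w : q v * qform G w <= qform A w.
  have [->|w0] := eqVneq w 0.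
    by rewrite /qform !mul0mx mxE mulr0.
  have := vmin _ (mem_set (nK _ w0)); rewrite /q !qformZ.
  have s0 : `|w|^-1 ^+ 2 != 0 by rewrite expf_neq0// invr_neq0// normr_eq0.
  rewrite -mulf_div divff// mul1r -/(q v) => h.
  by rewrite -ler_pdivlMr// G0.
exists (q v), v; split => //; first exact: K0.
apply/eqP; rewrite -subr_eq0 scalemxAr -mulmxBr; apply/eqP.
have qs u : qform (A - q v *: G) u = qform A u - q v * qform G u.
  by rewrite /qform mulmxBr mulmxBl -scalemxAr -scalemxAl !mxE.
apply: semidefinite_kernel.
- by rewrite linearB linearZ/= sA pG.1.
- by move=> u; rewrite qs subr_ge0.
- by rewrite qs /q divfK ?subrr// gt_eqF// G0// K0.
Qed.

(** The generalised eigenvector v gives the eigenvector v G of G^-1 A. *)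
Lemma lambda_min_le_qform A G d : posdef A -> posdef G ->
  d <= lambda_min (invmx G *m A) -> forall w, d * qform G w <= qform A w.
Proof.
move=> pA pG dl w; have uG := posdef_unit pG.
have [->|w0] := eqVneq w 0; first by rewrite /qform !mul0mx mxE mulr0.
have n0 : (0 < n)%N.
  rewrite lt0n; apply: contra_neq w0 => n0; apply/rowP => -[i iw].
  by exfalso; rewrite n0 in iw.
have [l [v [v0 vAG vmin]]] := rayleigh_minimum n0 pA.1 pG.
apply: le_trans (vmin w); rewrite ler_wpM2r ?posdef_qform_ge0//.
apply: (le_trans dl); apply: ge_inf.
  exists 0 => k /= /eigenvalueP[u uk u0].
  pose z := u *m invmx G; have zG : z *m G = u by rewrite mulmxKV.
  have z0 : z != 0 by apply: contra_neq u0 => z0; rewrite -zG z0 mul0mx.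
  have : qform A z = k * qform G z.
    have zA : z *m A = k *: u by rewrite -uk mulmxA.
    by rewrite /qform zA zG -scalemxAl mxE.
  have := pA.2 z z0; have := pG.2 z z0; rewrite -!/(qform _ _) => G0 A0 kE.
  by rewrite -(pmulr_lge0 _ G0) -kE ltW.
apply/eigenvalueP; exists (v *m G); last first.
  by apply: contra_neq v0 => vG; rewrite -(mulmxK uG v) vG mul0mx.
by rewrite mulmxA mulmxK.
Qed.

(** Inversion reverses the order of positive definite matrices; on the diagonal
    this is Cauchy-Schwarz for G between e_i A^-1 and e_i G^-1. *)
Lemma tr_inv_le A G (d : R) : posdef A -> posdef G -> 0 < d ->
  (forall w, d * qform G w <= qform A w) -> \tr (invmx A) <= d^-1 * \tr (invmx G).
Proof.
move=> pA pG d0 dGA; have uA := posdef_unit pA; have uG := posdef_unit pG.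
rewrite /mxtrace mulr_sumr; apply: ler_sum => i _.
pose e : 'rV[R]_n := delta_mx 0 i.
have qinv B : posdef B -> qform B (e *m invmx B) = invmx B i i.
  move=> pB; rewrite /qform mulmxKV ?posdef_unit// trmx_mul trmx_inv pB.1.
  by rewrite mulmxA /e trmx_delta -rowE -colE !mxE.
have cross : (e *m invmx A *m G *m (e *m invmx G)^T) 0 0 = invmx A i i.
  rewrite trmx_mul trmx_inv pG.1 mulmxA mulmxK// /e trmx_delta -rowE -colE.
  by rewrite !mxE.
have := qform_cauchy_schwarz (e *m invmx A) (e *m invmx G) pG.1
  (fun u => posdef_qform_ge0 u pG).
rewrite cross qinv// => cs.
have := dGA (e *m invmx A); rewrite qinv// => dA.
have r0 : 0 <= invmx G i i by rewrite -(qinv G)// posdef_qform_ge0.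
have s0 : 0 <= invmx A i i by rewrite -(qinv A)// posdef_qform_ge0.
have [->|sn0] := eqVneq (invmx A i i) 0.
  by rewrite mulr_ge0// invr_ge0 ltW.
have sp : 0 < invmx A i i by rewrite lt_neqAle eq_sym sn0.
rewrite ler_pdivlMl// -(ler_pM2l sp).
set s := invmx A i i in cs dA s0 sn0 sp *; set r := invmx G i i in cs r0 *.
by nra.
Qed.

End quadratic_forms.

(** * Comparison of norms of tensors *)

(** The factor between the metric and the Euclidean norm, for a distortion of at
    most t; the same value serves in both directions. *)
Definition comparison_const {R : realType} (n : nat) (t : R) : R :=
  (n * n)%:R * ((n ^ 2)%:R * t) ^+ 2 * ((n`!)%:R * t ^+ n).

Section comparison.
Context {R : realType} {n : nat} (A h : 'M[R]_n) (t : R).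
Hypotheses (pA : posdef A) (sh : h^T = h) (At : distortion A <= t).

Let t1 : 1 <= t. Proof. exact: le_trans (distortion_ge1 pA) At. Qed.
Let t0 : 0 <= t. Proof. exact: le_trans t1. Qed.

Let det_bound : (n`!)%:R * distortion A ^+ n <= (n`!)%:R * t ^+ n.
Proof. by rewrite ler_wpM2l// lerXn2r ?nnegrE// ltW// distortion_gt0. Qed.

Lemma energy_density_ge0 : 0 <= energy_density A h.
Proof. by rewrite mulr_ge0// ?metric_sqnorm_ge0// sqrtr_ge0. Qed.

Lemma energy_density_le_sqnorm :
  energy_density A h <= comparison_const n t * sqnorm h.
Proof.
rewrite /comparison_const -[leRHS]mulrAC; apply: ler_pM.
- exact: metric_sqnorm_ge0.
- exact: sqrtr_ge0.
- apply: (le_trans (metric_sqnorm_le pA sh)); rewrite ler_wpM2r ?sqnorm_ge0//.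
  rewrite ler_wpM2l// lerXn2r ?nnegrE ?mulr_ge0// ?posdef_tr_ge0//.
    exact: posdef_inv.
  by rewrite ler_wpM2l// (le_trans (tr_inv_le_distortion pA)).
- exact: le_trans (sqrt_det_le_distortion pA) det_bound.
Qed.

Lemma sqnorm_le_energy_density :
  sqnorm h <= comparison_const n t * energy_density A h.
Proof.
set k := Num.sqrt (metric_sqnorm A h); have k0 : 0 <= k by exact: sqrtr_ge0.
have k2 : metric_sqnorm A h = k ^+ 2 by rewrite sqr_sqrtr// metric_sqnorm_ge0.
have entry i j : `|h i j| <= (n ^ 2)%:R * t * k.
  apply: (le_trans (entry_le_metric i j pA sh)); rewrite -/k ler_wpM2r//.
  by rewrite ler_wpM2l// (le_trans (tr_le_distortion pA)).
apply: (le_trans (sqnorm_le entry)).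
have d0 : 0 < (n`!)%:R * t ^+ n.
  by rewrite mulr_gt0// ?ltr0n ?fact_gt0// exprn_gt0// (lt_le_trans _ t1).
have d1 : 1 <= (n`!)%:R * t ^+ n * Num.sqrt (\det A).
  rewrite -ler_pdivrMl// mulr1.
  apply: le_trans (sqrt_det_ge_distortion pA); rewrite lef_pV2 ?posrE//.
  by rewrite mulr_gt0// ?ltr0n ?fact_gt0// exprn_gt0// distortion_gt0.
rewrite /comparison_const /energy_density k2.
rewrite [leRHS](_ : _ = (n * n)%:R * ((n ^ 2)%:R * t * k) ^+ 2 *
  ((n`!)%:R * t ^+ n * Num.sqrt (\det A))); last by ring.
by rewrite ler_peMr// mulr_ge0// sqr_ge0.
Qed.

End comparison.

Section tensor_norms.
Context {R : realType} {n : nat} {M : topologicalType}.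
Variables (S : smooth_structure R n M) (A : amenable_atlas S).
Implicit Types (g h k : tensor R n M) (a : 'I_(asize A)).

Definition components a h (y : 'rV[R]_n) : 'M[R]_n :=
  comp S (aV a) h (cinv (aV a) y).

Local Notation range a := (cran (aV a)).
Local Notation J a := (@integral_rV R n (cmap (aV a) @` piece a)).

Let dom a := piece_domain a.

Lemma components_linear a g h (k : R) y :
  components a (g + k *: h) y = components a g y + k *: components a h y.
Proof. exact: comp_linear. Qed.

Lemma continuous_components a h i j : smooth_tensor S h ->
  {in range a, continuous (fun y => components a h y i j)}.
Proof. by apply: continuous_chart_comp; exact: aV_atlas. Qed.

Lemma components_posdef a g y : metrics S g -> range a y -> posdef (components a g y).
Proof.
move=> mg [x cx <-]; rewrite /components cmapK//.
apply: comp_posdef => //; first exact: aV_atlas.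
exact: (metrics_posdef _ mg).
Qed.

Lemma components_sym a h y : sym_tensors S h ->
  (components a h y)^T = components a h y.
Proof. by move=> [_ sh]; exact: comp_sym. Qed.

Lemma continuous_sqnorm a h : smooth_tensor S h ->
  {in range a, continuous (fun y => sqnorm (components a h y))}.
Proof.
move=> sh y Oy; apply: (@cvg_sqnorm _ _ (nbhs y)) => i j.
exact: continuous_components.
Qed.

Lemma continuous_components_energy a g h : metrics S g -> sym_tensors S h ->
  {in range a, continuous (fun y =>
    energy_density (components a g y) (components a h y))}.
Proof.
move=> mg sh; apply: continuous_energy_density.
- by move=> y; exact: components_posdef.
- by move=> i j; apply: continuous_components; case: mg => -[].
- by move=> i j; apply: continuous_components; case: sh.
Qed.

Lemma L2_energy g h : metrics S g ->
  L2 A g h h = \sum_a J a (fun y => energy_density (components a g y) (components a h y)).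
Proof.
move=> mg; rewrite /L2 /integral_M; apply: eq_bigr => a _.
apply: eq_integral_rV => _ [x [Ux _] <-].
have cx : cdom (aV a) x by exact/aKV/aUK.
rewrite /energy_density /components !cmapK// metric_sqnorm_comp//.
  exact: aV_atlas.
exact: (metrics_posdef _ mg).
Qed.

(** The Euclidean counterpart of the squared L2 norm, relative to the charts; all
    norms are compared with it. *)
Definition coordinate_energy h : R := \sum_a J a (fun y => sqnorm (components a h y)).

Definition distortion_bound g (t : R) : Prop :=
  forall a x, aU a x -> distortion (comp S (aV a) g x) <= t.

Lemma L2_ge0 g h : metrics S g -> sym_tensors S h -> 0 <= L2 A g h h.
Proof.
move=> mg sh; rewrite L2_energy//; apply: sumr_ge0 => a _.
apply: integral_rV_ge0 => _ [x [Ux _] <-]; apply: energy_density_ge0.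
  by apply: components_posdef => //; exists x => //; exact/aKV/aUK.
exact: components_sym.
Qed.

Let piece_bound a g t y : distortion_bound g t -> (cmap (aV a) @` piece a) y ->
  range a y /\ distortion (components a g y) <= t.
Proof.
move=> gt [x [Ux _] <-]; have cx : cdom (aV a) x by exact/aKV/aUK.
by split; [exists x|rewrite /components cmapK//; exact: gt].
Qed.

Lemma L2_le_coordinate_energy g h t : metrics S g -> sym_tensors S h ->
  distortion_bound g t -> L2 A g h h <= comparison_const n t * coordinate_energy h.
Proof.
move=> mg sh gt; rewrite L2_energy// /coordinate_energy mulr_sumr.
have [ch _] := sh; apply: ler_sum => a _.
rewrite -(integral_rVZ (dom a)); last exact: continuous_sqnorm.
apply: (le_integral_rV (dom a)).
- exact: continuous_components_energy.
- by apply: continuous_inM; [exact: continuous_in_cst|exact: continuous_sqnorm].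
move=> y /(piece_bound gt)[ry yt]; apply: energy_density_le_sqnorm => //.
  exact: components_posdef.
exact: components_sym.
Qed.

Lemma coordinate_energy_le_L2 g h t : metrics S g -> sym_tensors S h ->
  distortion_bound g t -> coordinate_energy h <= comparison_const n t * L2 A g h h.
Proof.
move=> mg sh gt; rewrite L2_energy// /coordinate_energy mulr_sumr.
have [ch _] := sh; apply: ler_sum => a _.
rewrite -(integral_rVZ (dom a)); last exact: continuous_components_energy.
apply: (le_integral_rV (dom a)).
- exact: continuous_sqnorm.
- apply: continuous_inM; first exact: continuous_in_cst.
  exact: continuous_components_energy.
move=> y /(piece_bound gt)[ry yt]; apply: sqnorm_le_energy_density => //.
  exact: components_posdef.
exact: components_sym.
Qed.

Lemma components0 a y : components a 0 y = 0.
Proof.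
rewrite /components /comp [(0 : tensor R n M) _](_ : _ = 0)//.
by rewrite mulmx0 mul0mx.
Qed.

Lemma coordinate_energyN h : coordinate_energy (- h) = coordinate_energy h.
Proof.
apply: eq_bigr => a _; apply: eq_integral_rV => y _.
have -> : - h = 0 + (-1) *: h by rewrite add0r scaleN1r.
rewrite components_linear components0.
rewrite add0r; apply: eq_bigr => i _; apply: eq_bigr => j _.
by rewrite mxE mulN1r sqrrN.
Qed.

(** The distortion is continuous on the compact sets K_a. *)
Lemma metrics_distortion_bound g : metrics S g -> exists2 t, 0 < t & distortion_bound g t.
Proof.
move=> mg; have /choice[t tP] : forall a, exists t : R, 0 < t /\
    forall y, (cmap (aV a) @` aK a) y -> `|distortion (components a g y)| <= t.
  move=> a; have [|c c0 cP] := @continuous_bounded_on_compact _ _ _ _ _ (dom a)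
    (fun y => distortion (components a g y)); last by exists c.
  move=> y Oy; apply: (@cvg_distortion _ _ _ (nbhs y)).
    by apply/posdef_unit/components_posdef => //; exact: set_mem.
  by move=> i j; apply: continuous_components => //; case: mg => -[].
have t0 : 0 <= \sum_a t a by apply: sumr_ge0 => a _; rewrite ltW//; case: (tP a).
exists (\sum_a t a + 1); first by rewrite ltr_wpDl.
move=> a x Ux; have Kx := aUK Ux; have [_ /(_ (cmap (aV a) x))] := tP a.
rewrite /components cmapK; last exact: aKV.
move=> h; apply: (le_trans (ler_norm _)); apply: (le_trans (h _)); first by exists x.
rewrite (bigD1 a)//= -addrA lerDl addr_ge0//.
by apply: sumr_ge0 => b _; rewrite ltW//; case: (tP b).
Qed.

(** The bound on the coefficients controls the trace of the components of gt; the
    eigenvalue bound says gt >= d g, which controls the trace of the inverse by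
    that of g. *)
Lemma amenable_distortion_bound g (U : set (tensor R n M)) : metrics S g ->
  amenable A g U -> exists2 t, 0 < t & forall gt, U gt -> distortion_bound gt t.
Proof.
move=> mg [Um _ [C [d [C0 d0 UP]]]].
have [t t0 gt] := metrics_distortion_bound mg.
exists (1 + n%:R * C + d^-1 * t).
  by rewrite addr_gt0 ?ltr_pwDl ?mulr_gt0 ?invr_gt0// mulr_ge0// ltW.
move=> k Uk a x Ux; have [kl kC] := UP k Uk.
have cx : cdom (aV a) x by exact/aKV/aUK.
have pk : posdef (comp S (aV a) k x).
  by apply: comp_posdef => //; [exact: aV_atlas|exact: (metrics_posdef _ (Um _ Uk))].
have pg : posdef (comp S (aV a) g x).
  by apply: comp_posdef => //; [exact: aV_atlas|exact: (metrics_posdef _ mg)].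
rewrite /distortion lerD// ?lerD2l.
  rewrite mulr_natl -[X in C *+ X](card_ord n) -sumr_const.
  by apply: ler_sum => i _; apply: (le_trans (ler_norm _)); exact: kC.
apply: (le_trans (tr_inv_le pk pg d0 _)) => [w|].
  have [v vE] := comp_qform S (aV a) x w.
  rewrite /qform !vE; apply: lambda_min_le_qform => //.
  - exact: (metrics_posdef _ (Um _ Uk)).
  - exact: (metrics_posdef _ mg).
rewrite ler_wpM2l ?invr_ge0 ?(ltW d0)//.
by apply: (le_trans (tr_inv_le_distortion pg)); exact: gt.
Qed.

End tensor_norms.

(** * Length of paths of metrics *)

Lemma integral_rV_sum {R : realType} {n : nat} (O Kc Om : set 'rV[R]_n)
    (I : Type) (r : seq I) (f : I -> 'rV[R]_n -> R) :
  integration_domain O Kc Om -> (forall i, {in O, continuous (f i)}) ->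
  integral_rV Om (fun y => \sum_(i <- r) f i y) = \sum_(i <- r) integral_rV Om (f i).
Proof.
move=> dom cf; elim: r => [|i r IH].
  rewrite big_nil -[RHS](mul0r (integral_rV Om (fun=> 1))) -(integral_rVZ dom).
    by apply: eq_integral_rV => y _; rewrite big_nil mul0r.
  exact: continuous_in_cst.
rewrite big_cons -IH -(integral_rVD dom)//.
  by apply: eq_integral_rV => y _; rewrite big_cons.
by move=> y Oy; apply: (@cvgr_sum _ _ (nbhs y)) => j; exact: cf.
Qed.

Section paths.
Context {R : realType} {n : nat} {M : topologicalType}.
Variables (S : smooth_structure R n M) (A : amenable_atlas S).
Implicit Types (g h k : tensor R n M) (a : 'I_(asize A)).

Local Notation range a := (cran (aV a)).
Local Notation J a := (@integral_rV R n (cmap (aV a) @` piece a)).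
Let dom a := piece_domain a.

Lemma smooth_cvg_components (F : set_system R) (u : R -> tensor R n M) l a i j :
  Filter F -> smooth_cvg A F u l ->
  unif_cvg (cmap (aV a) @` aK a) F (fun s y => components a (u s) y i j)
    (fun y => components a l y i j).
Proof.
move=> FF ul e e0; have := ul a i j [::] e e0; apply: filterS => s us.
move=> _ [x Kx <-]; have := us x Kx; rewrite /= -scaleN1r comp_linear.
by rewrite !mxE mulN1r.
Qed.

Lemma C1_path_coordinates (p p' : R -> tensor R n M) (s0 s1 : R) a :
  C1_path A p p' s0 s1 ->
  coordinate_path (range a) (cmap (aV a) @` aK a)
    (fun t => components a (p t)) (fun t => components a (p' t)) s0 s1.
Proof.
move=> pC1 t /pC1[mp sp' dp cp']; have [[smp _] _] := mp; have [smp' _] := sp'.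
split.
- by move=> y ry; split; [exact: components_posdef|exact: components_sym].
- by move=> i j; exact: continuous_components.
- by move=> i j; exact: continuous_components.
- move=> i j e e0.
  have : \forall s \near within `[s0, s1] t^', forall y, (cmap (aV a) @` aK a) y ->
      `|components a ((s - t)^-1 *: (p s - p t)) y i j -
        components a (p' t) y i j| < e by exact: (smooth_cvg_components a i j _ dp e0).
  apply: filterS => s us y Ky; have := us y Ky.
  have -> : (s - t)^-1 *: (p s - p t) =
      ((s - t)^-1 *: p s) + (- (s - t)^-1) *: p t :> tensor R n M.
    by rewrite scalerBr scaleNr.
  rewrite components_linear -[(s - t)^-1 *: p s]add0r components_linear.
  by rewrite components0 add0r !mxE mulrBr mulNr.
- by move=> i j; exact: smooth_cvg_components.
Qed.

Lemma continuous_speed (p p' : R -> tensor R n M) (s0 s1 t : R) :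
  C1_path A p p' s0 s1 -> t \in `[s0, s1] ->
  L2norm A (p s) (p' s) @[s --> within `[s0, s1] (nbhs t)] --> L2norm A (p t) (p' t).
Proof.
move=> pC1 tI; apply: cvg_sqrt.
have [mp _ _ _] := pC1 t tI.
rewrite (L2_energy A (p' t) mp).
have near_energy : \forall s \near within `[s0, s1] (nbhs t),
    \sum_(a < asize A) J a (fun y =>
      energy_density (components a (p s) y) (components a (p' s) y))
    = L2 A (p s) (p' s) (p' s).
  have inI : \forall s \near within `[s0, s1] (nbhs t), s \in `[s0, s1].
    exact: withinT.
  apply: filterS inI => s sI.
  by have [mps _ _ _] := pC1 s sI; rewrite L2_energy.
apply: cvg_trans (near_eq_cvg near_energy) _.
apply: cvgr_sum => a; apply: (cvg_energy (dom a)) => //.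
exact: C1_path_coordinates.
Qed.

Lemma path_length_ge0 (p : R -> tensor R n M) s0 s1 l :
  path_length A p s0 s1 l -> 0 <= l.
Proof.
elim=> [a b p' ab _|a b c l1 l2 _ l10 _ l20]; last exact: addr_ge0.
by apply: Rintegral_ge0 => t _; exact: sqrtr_ge0.
Qed.

(** The increments and the lengths of the C^1 pieces add up; the endpoints of the
    pieces may be arbitrary metrics. *)
Lemma path_length_observable (p : R -> tensor R n M) s0 s1 l a o
    (psi : 'rV[R]_n -> R) : {in range a, continuous psi} ->
  path_length A p s0 s1 l ->
  J a (fun y => observable o (components a (p s1) y) * psi y) -
  J a (fun y => observable o (components a (p s0) y) * psi y) <=
    Num.sqrt (lipschitz_const n * J a (fun y => psi y ^+ 2)) * l.
Proof.
move=> cpsi; elim=> [b c p' bc pC1|b c d l1 l2 _ IH1 _ IH2]; last first.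
  rewrite mulrDr; have := lerD IH2 IH1; rewrite addrA subrK => /le_trans; apply.
  by rewrite addrC.
apply: (observable_increment_le (dom a) (C1_path_coordinates a pC1)) => //.
  by move=> t tI; exact: continuous_speed.
move=> t tI; have [mp sp' _ _] := pC1 t tI.
split; first exact: sqrtr_ge0.
rewrite sqr_sqrtr ?L2_ge0// L2_energy// (bigD1 a)//= lerDl.
apply: sumr_ge0 => b' _; apply: integral_rV_ge0 => _ [x [Ux _] <-].
apply: energy_density_ge0; last exact: components_sym.
by apply: components_posdef => //; exists x => //; exact/aKV/aUK.
Qed.

(** Taking for psi the increment of the observable itself: if x is its squared
    norm, x <= sqrt (C x) l, whence x <= C l^2. *)
Lemma path_length_observable_sqr (p : R -> tensor R n M) s0 s1 l a o :
  metrics S (p s0) -> metrics S (p s1) -> path_length A p s0 s1 l ->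
  J a (fun y => (observable o (components a (p s1) y) -
    observable o (components a (p s0) y)) ^+ 2) <= lipschitz_const n * l ^+ 2.
Proof.
move=> m0 m1 pl; have l0 := path_length_ge0 pl.
have cO g : metrics S g ->
    {in range a, continuous (fun y => observable o (components a g y))}.
  move=> mg; apply: continuous_observable; first by move=> y; exact: components_posdef.
  by move=> i j; apply: continuous_components; case: mg => -[].
pose psi y := observable o (components a (p s1) y) +
  -1 * observable o (components a (p s0) y).
have cN : {in range a, continuous (fun y => -1 * observable o (components a (p s0) y))}.
  by apply: continuous_inM; [exact: continuous_in_cst|exact: cO].
have cpsi : {in range a, continuous psi} by apply: continuous_inD => //; exact: cO.
have := path_length_observable o cpsi pl.
have -> : J a (fun y => (observable o (components a (p s1) y) -
    observable o (components a (p s0) y)) ^+ 2) = J a (fun y => psi y ^+ 2).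
  by apply: eq_integral_rV => y _; rewrite /psi mulN1r.
have <- : J a (fun y => psi y ^+ 2) =
    J a (fun y => observable o (components a (p s1) y) * psi y) -
    J a (fun y => observable o (components a (p s0) y) * psi y).
  rewrite -[- J a _]mulN1r -(integral_rVZ (dom a)); last first.
    by apply: continuous_inM => //; exact: cO.
  rewrite -(integral_rVD (dom a)).
  - by apply: eq_integral_rV => y _; rewrite /psi; ring.
  - by apply: continuous_inM => //; exact: cO.
  - apply: continuous_inM; first exact: continuous_in_cst.
    by apply: continuous_inM => //; exact: cO.
set x := J a _; have x0 : 0 <= x by apply: integral_rV_ge0 => y _; exact: sqr_ge0.
have C0 : 0 <= lipschitz_const n :> R by rewrite mulr_ge0// sqr_ge0.
move=> xl; have [->|xn0] := eqVneq x 0; first by rewrite mulr_ge0// sqr_ge0.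
have xp : 0 < x by rewrite lt_neqAle eq_sym xn0.
have := xl; rewrite -ler_sqr ?nnegrE//; last by rewrite mulr_ge0// sqrtr_ge0.
rewrite exprMn sqr_sqrtr; last by rewrite mulr_ge0.
by rewrite expr2 mulrAC ler_pM2r.
Qed.

(** Collects the factors of [sqnorm_sub_le_observable] and
    [path_length_observable_sqr] over all the observables and charts. *)
Definition lower_const (t : R) : R :=
  (asize A)%:R * (2 * (n * n)%:R * t ^+ (2 * n.+2) *
    (#|{: option ('I_n * 'I_n)}|%:R * lipschitz_const n)).

Lemma coordinate_energy_le_length (p : R -> tensor R n M) s0 s1 l t : 0 < t ->
  metrics S (p s0) -> metrics S (p s1) ->
  distortion_bound A (p s0) t -> distortion_bound A (p s1) t ->
  path_length A p s0 s1 l ->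
  coordinate_energy A (p s1 - p s0) <= lower_const t * l ^+ 2.
Proof.
move=> t0 m0 m1 b0 b1 pl; have l0 := path_length_ge0 pl.
have cO o a g : metrics S g ->
    {in range a, continuous (fun y => observable o (components a g y))}.
  move=> mg; apply: continuous_observable; first by move=> y; exact: components_posdef.
  by move=> i j; apply: continuous_components; case: mg => -[].
rewrite /coordinate_energy.
rewrite [leRHS](_ : _ = \sum_(a < asize A) (2 * (n * n)%:R * t ^+ (2 * n.+2) *
    (#|{: option ('I_n * 'I_n)}|%:R * lipschitz_const n * l ^+ 2))); last first.
  by rewrite sumr_const card_ord -mulr_natl /lower_const; ring.
apply: ler_sum => a _.
pose d o y := (observable o (components a (p s1) y) -
  observable o (components a (p s0) y)) ^+ 2.
have cd o : {in range a, continuous (d o)}.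
  apply: continuous_inX => y Oy.
  by apply: (@cvgB _ _ _ (nbhs y)); [exact: cO|exact: cO].
apply: (@le_trans _ _ (J a (fun y => 2 * (n * n)%:R * t ^+ (2 * n.+2) * \sum_o d o y))).
  have csum : {in range a, continuous (fun y => \sum_o d o y)}.
    by move=> y Oy; apply: (@cvgr_sum _ _ (nbhs y)) => o; exact: cd.
  apply: (le_integral_rV (dom a)).
  - have -> : p s1 - p s0 = p s1 + (-1) *: p s0 by rewrite scaleN1r.
    apply: continuous_sqnorm; apply: smooth_tensor_linear.
      by case: m1 => -[].
    by case: m0 => -[].
  - by apply: continuous_inM => //; exact: continuous_in_cst.
  move=> _ [x [Ux _] <-].
  have rx : range a (cmap (aV a) x) by exists x => //; exact/aKV/aUK.
  rewrite -scaleN1r components_linear scaleN1r.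
  have cx : cdom (aV a) x by exact/aKV/aUK.
  apply: sqnorm_sub_le_observable; rewrite ?components_posdef//.
  - exact: components_posdef.
  - exact: components_posdef.
  - by rewrite /components cmapK//; exact: b0.
  - by rewrite /components cmapK//; exact: b1.
have csum : {in range a, continuous (fun y => \sum_o d o y)}.
  by move=> y Oy; apply: (@cvgr_sum _ _ (nbhs y)) => o; exact: cd.
rewrite (integral_rVZ (dom a))// ler_wpM2l//.
  by apply: mulr_ge0; [exact: mulr_ge0|exact/exprn_ge0/ltW].
rewrite (integral_rV_sum _ (dom a))//.
apply: (@le_trans _ _ (\sum_(o : option ('I_n * 'I_n)) lipschitz_const n * l ^+ 2)).
  by apply: ler_sum => o _; exact: path_length_observable_sqr.
by rewrite sumr_const cardT -cardE -mulrA mulr_natl.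
Qed.

End paths.

(** * Equivalence of the two distances on an amenable set *)

Section amenable_comparison.
Context {R : realType} {n : nat} {M : topologicalType}.
Variables (S : smooth_structure R n M) (A : amenable_atlas S).
Variables (g : tensor R n M) (U : set (tensor R n M)).
Hypotheses (mg : metrics S g) (hU : amenable A g U).

Let U_metrics g0 : U g0 -> metrics S g0. Proof. by case: hU => + _ _; exact. Qed.

Definition segment (g0 g1 : tensor R n M) (s : R) : tensor R n M := g0 + s *: (g1 - g0).

Let segment_in (g0 g1 : tensor R n M) (s : R) :
  U g0 -> U g1 -> s \in `[0, 1] -> U (segment g0 g1 s).
Proof.
move=> Ug0 Ug1; rewrite in_itv/= => /andP[s0 s1]; have [_ cU _] := hU.
have := cU g1 g0 (Itv01 s0 s1) (mem_set Ug1) (mem_set Ug0).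
have -> : conv (Itv01 s0 s1) (g1 : convex_lmodType (tensor R n M)) g0 =
    segment g0 g1 s.
  rewrite /segment /conv/= /unstable.onem scalerBl scale1r scalerBr.
  by rewrite addrCA.
exact: set_mem.
Qed.

Let velocity_sym g0 g1 : U g0 -> U g1 -> sym_tensors S (g1 - g0).
Proof.
move=> /U_metrics[s0 _] /U_metrics[s1 _].
by rewrite -scaleN1r; exact: sym_tensors_linear.
Qed.

(** The difference quotients of an affine path are equal to its velocity. *)
Lemma segment_C1 g0 g1 : U g0 -> U g1 ->
  C1_path A (segment g0 g1) (fun=> g1 - g0) 0 1.
Proof.
move=> Ug0 Ug1 t tI; split.
- exact/U_metrics/segment_in.
- exact: velocity_sym.
- move=> a i j s e e0.
  have ne : \forall s \near t^', s != t by exact: nbhs_dnbhs_neq.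
  have {}ne : \forall s \near within `[0, 1] t^', s != t.
    exact: cvg_within ne.
  apply: filterS ne => r rt x Kx.
  have -> : (r - t)^-1 *: (segment g0 g1 r - segment g0 g1 t) - (g1 - g0) = 0.
    rewrite /segment opprD addrACA subrr add0r -scalerBl scalerA mulVf ?subr_eq0//.
    by rewrite scale1r subrr.
  rewrite (_ : (fun y => _) = fun=> 0) ?pderivs0 ?normr0//.
  by apply/funext => y; rewrite [LHS](_ : _ = components a 0 y i j)// components0 mxE.
- move=> a i j s e e0; apply: nearW => r x Kx; rewrite subrr.
  rewrite (_ : (fun y => _) = fun=> 0) ?pderivs0 ?normr0//.
  by apply/funext => y; rewrite [LHS](_ : _ = components a 0 y i j)// components0 mxE.
Qed.

Lemma segment_length g0 g1 : U g0 -> U g1 ->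
  path_length A (segment g0 g1) 0 1
    (\int[lebesgue_measure]_(t in `[0, 1]) L2norm A (segment g0 g1 t) (g1 - g0)).
Proof. by move=> Ug0 Ug1; apply: path_length_C1; [exact: ltr01|exact: segment_C1]. Qed.

Lemma segment0 g0 g1 : segment g0 g1 0 = g0.
Proof. by rewrite /segment scale0r addr0. Qed.

Lemma segment1 g0 g1 : segment g0 g1 1 = g1.
Proof. by rewrite /segment scale1r addrC subrK. Qed.

Lemma comparison_const_ge0 (t : R) : 0 < t -> 0 <= comparison_const n t.
Proof.
by move=> t0; rewrite /comparison_const !mulr_ge0 ?exprn_ge0// ?sqr_ge0// ?mulr_ge0// ltW.
Qed.

(** The segment stays in U by convexity, so that its speed is bounded
    by a multiple of the Euclidean norm of g1 - g0. *)
Lemma L2_distance_le_coordinate_energy t g0 g1 : 0 < t ->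
  (forall k, U k -> distortion_bound A k t) -> U g0 -> U g1 ->
  L2_distance A g0 g1 <=
    Num.sqrt (comparison_const n t * coordinate_energy A (g1 - g0)).
Proof.
move=> t0 Ut Ug0 Ug1; set m := Num.sqrt _.
have pl := segment_length Ug0 Ug1.
have speed s : s \in `[0, 1] -> L2norm A (segment g0 g1 s) (g1 - g0) <= m.
  move=> sI; apply: ler_wsqrtr; apply: L2_le_coordinate_energy.
  - exact/U_metrics/segment_in.
  - exact: velocity_sym.
  - exact/Ut/segment_in.
apply: (@le_trans _ _ (\int[lebesgue_measure]_(t in `[0, 1])
    L2norm A (segment g0 g1 t) (g1 - g0))).
  apply: ge_inf.
    by exists 0 => l [p [a [b [_ _ /path_length_ge0]]]].
  by exists (segment g0 g1), 0, 1; split; rewrite ?segment0 ?segment1.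
have iN : lebesgue_measure.-integrable `[0, 1]
    (EFin \o (fun s => L2norm A (segment g0 g1 s) (g1 - g0))).
  apply: continuous_compact_integrable; first exact: segment_compact.
  apply/subspace_continuousP => s sI.
  exact: (continuous_speed (segment_C1 Ug0 Ug1)).
have im : lebesgue_measure.-integrable `[0, 1] (EFin \o (fun _ : R => m)).
  apply: continuous_compact_integrable; first exact: segment_compact.
  by move=> s; exact: cvg_cst.
apply: (@le_trans _ _ (\int[lebesgue_measure]_(t in `[0, 1]) m)).
  by apply: le_Rintegral => // s; exact: speed.
have mu1 : lebesgue_measure (`[0, 1]%classic : set R) = 1%E.
  by rewrite lebesgue_measure_itv/= lte_fin ltr01 oppr0 adde0.
rewrite Rintegral_cst//.
have -> : fine (lebesgue_measure (`[0, 1]%classic : set R)) = 1 by rewrite mu1.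
by rewrite mulr1.
Qed.

Lemma coordinate_energy_le_L2_distance t g0 g1 : 0 < t ->
  (forall k, U k -> distortion_bound A k t) -> U g0 -> U g1 ->
  Num.sqrt (coordinate_energy A (g1 - g0)) <=
    Num.sqrt (lower_const A t) * L2_distance A g0 g1.
Proof.
move=> t0 Ut Ug0 Ug1; have pl := segment_length Ug0 Ug1.
set C := Num.sqrt (lower_const A t); have C0 : 0 <= C by exact: sqrtr_ge0.
have bound (p : R -> tensor R n M) a b l : p a = g0 -> p b = g1 ->
    path_length A p a b l -> Num.sqrt (coordinate_energy A (g1 - g0)) <= C * l.
  move=> pa pb pabl; have l0 := path_length_ge0 pabl.
  have L0 : 0 <= lower_const A t.
    apply: mulr_ge0 => //; apply: mulr_ge0.
      by apply: mulr_ge0; [exact: mulr_ge0|exact/exprn_ge0/ltW].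
    by apply: mulr_ge0 => //; apply: mulr_ge0 => //; exact: sqr_ge0.
  rewrite -[C * l]ger0_norm ?mulr_ge0// -sqrtr_sqr; apply: ler_wsqrtr.
  rewrite exprMn sqr_sqrtr// -pa -pb.
  by apply: (coordinate_energy_le_length _ _ _ _ _ pabl) => //;
    rewrite ?pa ?pb; first [exact: U_metrics|exact: Ut].
have [C_0|Cn0] := eqVneq C 0.
  by have := bound _ _ _ _ (segment0 g0 g1) (segment1 g0 g1) pl; rewrite C_0 !mul0r.
have Cp : 0 < C by rewrite lt_neqAle eq_sym Cn0.
rewrite -ler_pdivrMl//; apply: lb_le_inf.
  eexists; exists (segment g0 g1), 0, 1; split; last exact: pl.
    exact: segment0.
  exact: segment1.
move=> l [p [a [b [pa pb pabl]]]]; rewrite ler_pdivrMl//.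
exact: bound pa pb pabl.
Qed.

(** Both distances are equivalent to the Euclidean one of the coordinates: an
    arbitrary path bounds it by [coordinate_energy_le_length], the segment
    realises it up to a factor. *)
Lemma L2_distance_equiv_L2dist : exists2 K : R, 0 < K &
  forall g0 g1, U g0 -> U g1 ->
    L2dist A g g0 g1 <= K * L2_distance A g0 g1 /\
    L2_distance A g0 g1 <= K * L2dist A g g0 g1.
Proof.
have [t t0 Ut] := amenable_distortion_bound mg hU.
have [s s0 gs] := metrics_distortion_bound A mg.
pose K1 := Num.sqrt (comparison_const n s) * Num.sqrt (lower_const A t).
pose K2 := Num.sqrt (comparison_const n t) * Num.sqrt (comparison_const n s).
have K10 : 0 <= K1 by rewrite mulr_ge0// sqrtr_ge0.
have K20 : 0 <= K2 by rewrite mulr_ge0// sqrtr_ge0.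
have cs0 := comparison_const_ge0 s0; have ct0 := comparison_const_ge0 t0.
exists (K1 + K2 + 1); first by rewrite ltr_wpDl// addr_ge0.
move=> g0 g1 Ug0 Ug1.
have E01 : coordinate_energy A (g0 - g1) = coordinate_energy A (g1 - g0).
  by rewrite -coordinate_energyN opprB.
have sym01 : sym_tensors S (g0 - g1) by exact: velocity_sym.
have e1 : L2dist A g g0 g1 <=
    Num.sqrt (comparison_const n s) * Num.sqrt (coordinate_energy A (g1 - g0)).
  rewrite -sqrtrM// -E01; apply: ler_wsqrtr; exact: L2_le_coordinate_energy.
have e2 : Num.sqrt (coordinate_energy A (g1 - g0)) <=
    Num.sqrt (comparison_const n s) * L2dist A g g0 g1.
  rewrite -sqrtrM// -E01; apply: ler_wsqrtr; exact: coordinate_energy_le_L2.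
have e3 := coordinate_energy_le_L2_distance t0 Ut Ug0 Ug1.
have e4 := L2_distance_le_coordinate_energy t0 Ut Ug0 Ug1.
rewrite sqrtrM// in e4.
have d0 : 0 <= L2_distance A g0 g1.
  apply: lb_le_inf; last by move=> l [p [a [b [_ _ /path_length_ge0]]]].
  eexists; exists (segment g0 g1), 0, 1.
  by split; [exact: segment0|exact: segment1|exact: segment_length].
have n0 : 0 <= L2dist A g g0 g1 by exact: sqrtr_ge0.
split.
- apply: (le_trans e1); apply: (@le_trans _ _ (K1 * L2_distance A g0 g1)).
    by rewrite /K1 -mulrA ler_wpM2l// sqrtr_ge0.
  by rewrite ler_wpM2r// -addrA lerDl addr_ge0.
- apply: (le_trans e4); apply: (@le_trans _ _ (K2 * L2dist A g g0 g1)).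
    by rewrite /K2 -mulrA ler_wpM2l// sqrtr_ge0.
  by rewrite ler_wpM2r// addrAC lerDr addr_ge0.
Qed.

End amenable_comparison.

(** * Lipschitz maps between completions *)

Section completions.
Context {R : realType}.

Definition seq_complete (Y : metricType R) : Prop :=
  forall u : nat -> Y, cauchy (u @ \oo) -> exists l : Y, u @ \oo --> l.

Lemma dense_mdist (T : Type) (Y : metricType R) (i : T -> Y) : dense (range i) ->
  forall y e, 0 < e -> exists x, mdist (i x) y < e.
Proof.
move=> di y e e0; have [|z [bz [x _ xz]]] := di (ball y e)° _ (@open_interior _ _).
  by exists y; exact: nbhsx_ballx.
exists x; rewrite xz metric_sym.
by have := interior_subset bz; rewrite ballEmdist.
Qed.

Lemma lipschitz_continuous (Y Z : metricType R) (F : Y -> Z) (K : R) : 0 < K ->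
  (forall y y', mdist (F y) (F y') <= K * mdist y y') -> unif_continuous F.
Proof.
move=> K0 lF; apply/unif_continuousP => e e0.
exists (e / K); first by rewrite divr_gt0.
move=> [y y'] /=; rewrite !ballEmdist/= => h; apply: (le_lt_trans (lF _ _)).
by rewrite mulrC -ltr_pdivlMr.
Qed.

Lemma unif_continuous_continuous (Y Z : metricType R) (F : Y -> Z) :
  unif_continuous F -> continuous F.
Proof.
move=> /unif_continuousP uF y; apply/cvg_ballP => e e0.
have [d d0 dF] := uF e e0; near=> z; apply: (dF (y, z)) => /=.
by near: z; exact: nbhsx_ballx.
Unshelve. all: by end_near. Qed.

Lemma eq_on_dense (T : Type) (Y Z : metricType R) (i : T -> Y) (F G : Y -> Z) :
  dense (range i) -> continuous F -> continuous G ->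
  (forall x, F (i x) = G (i x)) -> F = G.
Proof.
move=> di cF cG FG; apply/funext => y; apply: mdist_positivity.
apply/eqP; rewrite eq_le mdist_ge0 andbT; apply/ler_addgt0Pl => e e0.
have e2 : 0 < e / 2 by rewrite divr_gt0.
have Fe : \forall x \near y, ball (F y) (e / 2) (F x).
  by move: (cF y) => /cvg_ballP; exact.
have Ge : \forall x \near y, ball (G y) (e / 2) (G x).
  by move: (cG y) => /cvg_ballP; exact.
have : nbhs y ((F @^-1` ball (F y) (e / 2)) `&` (G @^-1` ball (G y) (e / 2))).
  exact: filterI.
move=> /nbhs_ballP[d /= d0 dy].
have [x xy] := dense_mdist di y d0.
have [] : (ball (F y) (e / 2) (F (i x))) /\ (ball (G y) (e / 2) (G (i x))).
  by apply: dy; rewrite ballEmdist/= metric_sym.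
rewrite !ballEmdist/= -FG => h1 h2.
rewrite addr0; apply: (le_trans (metric_triangle _ (F (i x)) _)).
by rewrite [e]splitr lerD// ltW// metric_sym.
Qed.

(** A point of Y and its image are the limits of the same points of T. *)
Lemma lipschitz_extension (T : Type) (Y Z : metricType R) (i : T -> Y) (j : T -> Z)
    (K : R) : 0 < K -> dense (range i) -> seq_complete Z ->
  (forall x x', mdist (j x) (j x') <= K * mdist (i x) (i x')) ->
  exists F : Y -> Z, (forall x, F (i x) = j x) /\
    forall y y', mdist (F y) (F y') <= K * mdist y y'.
Proof.
move=> K0 di cZ ij.
(* y and z are approximated by the same points of T *)
pose rel y z := forall e, 0 < e -> exists x, mdist (i x) y < e /\ mdist (j x) z < e.
have rel_lip y z y' z' : rel y z -> rel y' z' -> mdist z z' <= K * mdist y y'.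
  move=> yz yz'; apply/ler_addgt0Pl => e e0.
  (* the approximations cost 2 d in Z, and 2 d in Y that count K times *)
  pose d := e / (2 + 2 * K); have d0 : 0 < d.
    by rewrite divr_gt0// addr_gt0// mulr_gt0.
  have [x [xy xz]] := yz d d0; have [x' [xy' xz']] := yz' d d0.
  have h1 := metric_triangle z (j x) z'.
  have h2 := metric_triangle (j x) (j x') z'.
  have h3 := metric_triangle (i x) y (i x').
  have h4 := metric_triangle y y' (i x').
  have h5 := ij x x'.
  rewrite (metric_sym z (j x)) in h1; rewrite (metric_sym y' (i x')) in h4.
  have eE : e = 2 * d + 2 * K * d.
    by rewrite /d; field; rewrite gt_eqF// addr_gt0// mulr_gt0.
  have h6 : K * mdist (i x) (i x') <= K * (2 * d + mdist y y').
    by rewrite ler_wpM2l ?(ltW K0)//; lra.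
  by rewrite eE; lra.
have /choice[F relF] : forall y, exists z, rel y z.
  move=> y; have inv0 (k : nat) : 0 < k.+1%:R^-1 :> R by rewrite invr_gt0.
  have /choice[u uP] := fun k : nat => dense_mdist di y (inv0 k).
  have small e : 0 < e -> \forall k \near \oo, k.+1%:R^-1 < e :> R.
    by move=> e0; exact: near_infty_natSinv_lt (PosNum e0).
  have [|z jz] := cZ (j \o u).
    apply: cauchy_exP => e e0.
    have d0 : 0 < e / (2 * K) by rewrite divr_gt0// mulr_gt0.
    have [k kd] := @filter_ex _ _ _ _ (small _ d0).
    exists (j (u k)); have := small _ d0; apply: filterS => l ld.
    rewrite /= ballEmdist/=.
    apply: (le_lt_trans (ij _ _)).
    have h := metric_triangle (i (u k)) y (i (u l)); rewrite (metric_sym y) in h.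
    have h2 : mdist (i (u k)) (i (u l)) < 2 * (e / (2 * K)).
      by have := lt_trans (uP k) kd; have := lt_trans (uP l) ld; lra.
    have -> : e = K * (2 * (e / (2 * K))) by field; rewrite gt_eqF.
    by rewrite ltr_pM2l.
  exists z => e e0; have h1 := small e e0.
  have h2 : \forall k \near \oo, ball z e (j (u k)).
    by move: jz => /cvg_ballP; exact.
  have [k [k1 k2]] := @filter_ex _ _ _ _ (filterI h1 h2).
  exists (u k); split; first exact: lt_trans (uP k) k1.
  by move: k2; rewrite ballEmdist/= metric_sym.
have rel_id x : rel (i x) (j x) by move=> e e0; exists x; rewrite !mdistxx.
exists F; split=> [x|y y']; last exact: rel_lip.
apply: mdist_positivity; apply/eqP; rewrite eq_le mdist_ge0 andbT.
by have := rel_lip _ _ _ _ (relF (i x)) (rel_id x); rewrite mdistxx mulr0.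
Qed.

(** Both the identity of T and its inverse extend to the completions; D is the
    distance of Y carried to Z by the inverse extension G. *)
Lemma bilipschitz_completions (T : Type) (Y Z : metricType R) (i : T -> Y)
    (j : T -> Z) (K : R) : 0 < K ->
  dense (range i) -> seq_complete Y -> dense (range j) -> seq_complete Z ->
  (forall x x', mdist (j x) (j x') <= K * mdist (i x) (i x')) ->
  (forall x x', mdist (i x) (i x') <= K * mdist (j x) (j x')) ->
  exists F : Y -> Z,
    [/\ unif_continuous F /\ (forall x, F (i x) = j x),
        forall F' : Y -> Z, unif_continuous F' ->
          (forall x, F' (i x) = j x) -> F' = F,
        exists G : Z -> Y, [/\ cancel F G, cancel G F, continuous F & continuous G] &
        exists D : Z -> Z -> R,
          [/\ is_distance D,
              forall (z0 z1 : Z) (u0 u1 : nat -> T),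
                j \o u0 @ \oo --> z0 -> j \o u1 @ \oo --> z1 ->
                mdist (i (u0 k)) (i (u1 k)) @[k --> \oo] --> D z0 z1 &
              forall y0 y1 : Y, D (F y0) (F y1) = mdist y0 y1]].
Proof.
move=> K0 di cY dj cZ ij ji.
have [F [Fi Flip]] := lipschitz_extension K0 di cZ ij.
have [G [Gj Glip]] := lipschitz_extension K0 dj cY ji.
have uF := lipschitz_continuous K0 Flip; have uG := lipschitz_continuous K0 Glip.
have cF := unif_continuous_continuous uF; have cG := unif_continuous_continuous uG.
have GFid : G \o F = id.
  apply: (eq_on_dense di) => [y|y|x]; last by rewrite /= Fi Gj.
    by apply: continuous_comp; [exact: cF|exact: cG].
  exact: cvg_id.
have FGid : F \o G = id.
  apply: (eq_on_dense dj) => [y|y|x]; last by rewrite /= Gj Fi.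
    by apply: continuous_comp; [exact: cG|exact: cF].
  exact: cvg_id.
have FK : cancel F G by move=> y; exact: (congr1 (fun u => u y) GFid).
have GK : cancel G F by move=> y; exact: (congr1 (fun u => u y) FGid).
exists F; split=> //.
- move=> F' uF' F'i; apply: (eq_on_dense di) => //.
    exact: unif_continuous_continuous.
  by move=> x; rewrite F'i Fi.
- by exists G.
exists (fun z0 z1 => mdist (G z0) (G z1)); split.
- split=> [z0 z1|z0 z1|z0 z1 z2].
  + split=> [/mdist_positivity/(congr1 F)|->]; first by rewrite !GK.
    exact: mdistxx.
  + exact: metric_sym.
  + exact: metric_triangle.
- move=> z0 z1 u0 u1 c0 c1; apply/cvgrPdist_lt => e e0.
  have e2 : 0 < e / 2 by rewrite divr_gt0.
  have G0 : G (j (u0 k)) @[k --> \oo] --> G z0.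
    by apply: continuous_cvg; [exact: cG|exact: c0].
  have G1 : G (j (u1 k)) @[k --> \oo] --> G z1.
    by apply: continuous_cvg; [exact: cG|exact: c1].
  near=> k.
  have : ball (G z0) (e / 2) (G (j (u0 k))) by near: k; exact: cvg_ball.
  have : ball (G z1) (e / 2) (G (j (u1 k))) by near: k; exact: cvg_ball.
  rewrite !ballEmdist/= !Gj; set a := i (u0 k); set b := i (u1 k).
  have h1 := metric_triangle (G z0) a (G z1).
  have h2 := metric_triangle a b (G z1).
  have h3 := metric_triangle a (G z0) b.
  have h4 := metric_triangle (G z0) (G z1) b.
  rewrite (metric_sym b) in h2; rewrite (metric_sym a (G z0)) in h3.
  by move=> ? ?; rewrite ltr_norml; apply/andP; split; lra.
by move=> y0 y1; rewrite !FK.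
Unshelve. all: by end_near. Qed.

End completions.

(** * The completion of an amenable set *)

Theorem theorem3p9 (R : realType) (n : nat) (M : topologicalType)
  (S : smooth_structure R n M) (A : amenable_atlas S)
  (hM : closed_manifold M) (hor : orientable S)
  (g : tensor R n M) (hg : metrics S g)
  (U : set (tensor R n M)) (hU : amenable A g U)
  (Y Z : metricType R) (iY : U -> Y) (iZ : U -> Z)
  (hY : is_completion (L2_distance A) iY)
  (hZ : is_completion (L2dist A g) iZ) :
  exists F : Y -> Z,
    [/\        unif_continuous F /\ (forall h : U, F (iY h) = iZ h),
        forall F' : Y -> Z, unif_continuous F' ->
          (forall h : U, F' (iY h) = iZ h) -> F' = F,
        exists G : Z -> Y, [/\ cancel F G, cancel G F, continuous F & continuous G] &
        exists D : Z -> Z -> R,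
          [/\ is_distance D,
              forall (g0 g1 : Z) (u0 u1 : nat -> U),
                iZ \o u0 @ \oo --> g0 -> iZ \o u1 @ \oo --> g1 ->
                L2_distance A (\val (u0 k)) (\val (u1 k)) @[k --> \oo] --> D g0 g1 &
              forall y0 y1 : Y, D (F y0) (F y1) = mdist y0 y1]].
Proof.
have [K K0 KP] := L2_distance_equiv_L2dist hg hU.
have [dY denseY cY] := hY; have [dZ denseZ cZ] := hZ.
have inU (x : U) : U (\val x) by exact: set_mem (valP x).
have [x x'|x x'|F [FP Funiq FG [D [Dd Dlim Diso]]]] :=
    bilipschitz_completions K0 denseY cY denseZ cZ.
- by rewrite dY dZ; case: (KP _ _ (inU x) (inU x')).
- by rewrite dY dZ; case: (KP _ _ (inU x) (inU x')).
exists F; split => //; exists D; split => // g0 g1 u0 u1 c0 c1.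
by under eq_fun do rewrite -dY; exact: Dlim.
Qed.
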